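(* Let $\mathcal{M} \models \mathrm{KP}^\mathcal{P} + \Sigma_1^\mathcal{P}\text{-Separation}$ be countable and non-standard. Let $\mathcal{S}$ be a rank-cut of $\mathcal{M}$. Then there is a rank-cut $i : \mathcal{M} \rightarrow \mathcal{M}$ (that is, a topless rank-initial self-embedding), fixing $\mathcal{S}$ pointwise, such that for every $\alpha \in \mathrm{Ord}^\mathcal{M} \setminus \mathcal{S}$ there is $m \in \mathcal{M}$ with $\mathrm{rank}^\mathcal{M}(m) = \alpha$ and $i(m) \neq m$.
   Context: $\mathcal{L}^0$ is the first-order language of set theory, with the binary symbol $\in$. Takahashi hierarchy: $\Delta_0^\mathcal{P}=\Sigma_0^\mathcal{P}=\Pi_0^\mathcal{P}$ is the set of $\mathcal{L}^0$-formulae all of whose quantifiers are of the forms $\exists x\in y$, $\forall x\in y$, $\exists x\subseteq y$, $\forall x\subseteq y$; $\Sigma_{n+1}^\mathcal{P}$ consists of formulae $\exists x\,\phi$ with $\phi\in\Pi_n^\mathcal{P}$, and $\Pi_{n+1}^\mathcal{P}$ of formulae $\forall x\,\phi$ with $\phi\in\Sigma_n^\mathcal{P}$ (all up to provable equivalence in $\mathrm{KP}^\mathcal{P}$). $\mathrm{KP}^\mathcal{P}$ has the axioms Extensionality, Pair, Union, Powerset, Infinity, and the schemata (with parameters) $\Delta_0^\mathcal{P}$-Separation, $\Delta_0^\mathcal{P}$-Collection ($\forall x(\forall u\in x\,\exists v\,\phi(u,v)\to\exists y\,\forall u\in x\,\exists v\in y\,\phi(u,v))$), and $\Pi_1^\mathcal{P}$-Foundation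 ($\exists x\,\phi(x)\to\exists y(\phi(y)\wedge\forall v\in y\,\neg\phi(v))$). $\Gamma$-Separation is the Separation schema for formulae in $\Gamma$. A model is non-standard if its interpretation of $\in$ is not well-founded. $\mathrm{Ord}^\mathcal{N}$ is the class of ordinals of $\mathcal{N}$, and $\mathcal{N}_\alpha=\{n\in\mathcal{N}\mid\mathcal{N}\models\mathrm{rank}(n)<\alpha\}$. An embedding $i:\mathcal{M}\to\mathcal{N}$ is an injection with $\mathcal{M}\models x\in y\Leftrightarrow\mathcal{N}\models i(x)\in i(y)$. It is rank-initial if whenever $m\in\mathcal{M}$, $n\in\mathcal{N}$ and $\mathcal{N}\models\mathrm{rank}(n)\le\mathrm{rank}(i(m))$, then $n\in i(\mathcal{M})$. It is bounded if $i(\mathcal{M})\subseteq\mathcal{N}_\alpha$ for some $\alpha\in\mathrm{Ord}^\mathcal{N}$; it is topless if it is bounded and for every $\beta\in\mathrm{Ord}^\mathcal{N}\setminus i(\mathcal{M})$ there is $\beta'\in\mathrm{Ord}^\mathcal{N}\setminus i(\mathcal{M})$ with $\beta'<^\mathcal{N}\beta$. A rank-cut is a topless rank-initial embedding. A substructure $\mathcal{S}$ of $\mathcal{M}$ is a rank-cut of $\mathcal{M}$ if its inclusion map into $\mathcal{M}$ is rank-initial and topless. *)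

(* Defs.v *)
From Stdlib Require Import List FinFun.
Import ListNotations.

Set Implicit Arguments.

(** * The first-order language of set theory *)

(* Formulas in de Bruijn style: a variable is a natural number, and the
   quantifiers bind variable 0.  The only terms are variables, so substitution
   is renaming. *)
Inductive fml : Type :=
| Mem (x y : nat)
| Eq (x y : nat)
| Bot
| Imp (p q : fml)
| And (p q : fml)
| Or (p q : fml)
| All (p : fml)
| Ex (p : fml).

Definition Neg (p : fml) : fml := Imp p Bot.
Definition Iff (p q : fml) : fml := And (Imp p q) (Imp q p).

Definition up (r : nat -> nat) (n : nat) : nat :=
  match n with 0 => 0 | S k => S (r k) end.

Fixpoint ren (r : nat -> nat) (p : fml) : fml :=
  match p with
  | Mem x y => Mem (r x) (r y)
  | Eq x y => Eq (r x) (r y)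
  | Bot => Bot
  | Imp p q => Imp (ren r p) (ren r q)
  | And p q => And (ren r p) (ren r q)
  | Or p q => Or (ren r p) (ren r q)
  | All p => All (ren (up r) p)
  | Ex p => Ex (ren (up r) p)
  end.

Definition shift : fml -> fml := ren S.
Definition inst (t : nat) : fml -> fml :=
  ren (fun n => match n with 0 => t | S k => k end).

(* Bounded quantifiers.  The bound [y] is a variable of the outer context, so
   it is distinct from the variable being bound. *)
Definition Sub (x y : nat) : fml := All (Imp (Mem 0 (S x)) (Mem 0 (S y))).
Definition AllIn (y : nat) (p : fml) : fml := All (Imp (Mem 0 (S y)) p).
Definition ExIn (y : nat) (p : fml) : fml := Ex (And (Mem 0 (S y)) p).
Definition AllSub (y : nat) (p : fml) : fml := All (Imp (Sub 0 (S y)) p).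
Definition ExSub (y : nat) (p : fml) : fml := Ex (And (Sub 0 (S y)) p).

(** * The Takahashi hierarchy, syntactically *)

Inductive Delta0P : fml -> Prop :=
| D_Mem x y : Delta0P (Mem x y)
| D_Eq x y : Delta0P (Eq x y)
| D_Bot : Delta0P Bot
| D_Imp p q : Delta0P p -> Delta0P q -> Delta0P (Imp p q)
| D_And p q : Delta0P p -> Delta0P q -> Delta0P (And p q)
| D_Or p q : Delta0P p -> Delta0P q -> Delta0P (Or p q)
| D_AllIn y p : Delta0P p -> Delta0P (AllIn y p)
| D_ExIn y p : Delta0P p -> Delta0P (ExIn y p)
| D_AllSub y p : Delta0P p -> Delta0P (AllSub y p)
| D_ExSub y p : Delta0P p -> Delta0P (ExSub y p).

Fixpoint SigmaP_syn (n : nat) (p : fml) : Prop :=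
  match n with
  | 0 => Delta0P p
  | S k => exists q, PiP_syn k q /\ p = Ex q
  end
with PiP_syn (n : nat) (p : fml) : Prop :=
  match n with
  | 0 => Delta0P p
  | S k => exists q, SigmaP_syn k q /\ p = All q
  end.

(** * The theory KP^P *)

(* The axioms of a theory may have free variables, which are read as
   universally quantified. *)
Definition theory := fml -> Prop.

Definition ax_extensionality : fml :=
  All (All (Imp (All (Iff (Mem 0 2) (Mem 0 1))) (Eq 1 0))).

Definition ax_pair : fml :=
  All (All (Ex (All (Iff (Mem 0 1) (Or (Eq 0 3) (Eq 0 2)))))).

Definition ax_union : fml :=
  All (Ex (All (Iff (Mem 0 1) (ExIn 2 (Mem 1 0))))).

Definition ax_powerset : fml :=
  All (Ex (All (Iff (Mem 0 1) (Sub 0 2)))).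

Definition fml_empty (x : nat) : fml := All (Neg (Mem 0 (S x))).

(* y = x \cup {x} *)
Definition fml_succ (y x : nat) : fml :=
  All (Iff (Mem 0 (S y)) (Or (Mem 0 (S x)) (Eq 0 (S x)))).

Definition ax_infinity : fml :=
  Ex (And (ExIn 0 (fml_empty 0)) (AllIn 0 (ExIn 1 (fml_succ 0 1)))).

(* forall a, exists b, forall x, x \in b <-> x \in a /\ p(x),
   where in [p] variable 0 is x and the variables k+1 are parameters. *)
Definition ax_separation (p : fml) : fml :=
  All (Ex (All (Iff (Mem 0 1)
    (And (Mem 0 2) (ren (up (fun k => k + 2)) p))))).

(* forall a, (forall u \in a, exists v, p(u,v)) ->
     exists b, forall u \in a, exists v \in b, p(u,v),
   where in [p] variable 0 is v, variable 1 is u, and the variables k+2 are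
   parameters. *)
Definition ax_collection (p : fml) : fml :=
  All (Imp (AllIn 0 (Ex (ren (up (up (fun k => k + 1))) p)))
    (Ex (AllIn 1 (ExIn 1 (ren (up (up (fun k => k + 2))) p))))).

(* (exists x, p(x)) -> exists y, p(y) /\ forall v \in y, ~ p(v) *)
Definition ax_foundation (p : fml) : fml :=
  Imp (Ex p) (Ex (And p (AllIn 0 (Neg (ren (up (fun k => k + 1)) p))))).

Inductive KPP : theory :=
| KPP_extensionality : KPP ax_extensionality
| KPP_pair : KPP ax_pair
| KPP_union : KPP ax_union
| KPP_powerset : KPP ax_powerset
| KPP_infinity : KPP ax_infinity
| KPP_separation p : Delta0P p -> KPP (ax_separation p)
| KPP_collection p : Delta0P p -> KPP (ax_collection p)
| KPP_foundation p : PiP_syn 1 p -> KPP (ax_foundation p).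

(** * Provability: classical natural deduction with equality *)

Inductive prv (T : theory) : list fml -> fml -> Prop :=
| P_axiom G p : T p -> prv T G p
| P_hyp G p : In p G -> prv T G p
| P_contra G p : prv T (Neg p :: G) Bot -> prv T G p
| P_impI G p q : prv T (p :: G) q -> prv T G (Imp p q)
| P_impE G p q : prv T G (Imp p q) -> prv T G p -> prv T G q
| P_andI G p q : prv T G p -> prv T G q -> prv T G (And p q)
| P_andE1 G p q : prv T G (And p q) -> prv T G p
| P_andE2 G p q : prv T G (And p q) -> prv T G q
| P_orI1 G p q : prv T G p -> prv T G (Or p q)
| P_orI2 G p q : prv T G q -> prv T G (Or p q)
| P_orE G p q r :
    prv T G (Or p q) -> prv T (p :: G) r -> prv T (q :: G) r -> prv T G r
| P_allI G p : prv T (map shift G) p -> prv T G (All p)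
| P_allE G p t : prv T G (All p) -> prv T G (inst t p)
| P_exI G p t : prv T G (inst t p) -> prv T G (Ex p)
| P_exE G p q :
    prv T G (Ex p) -> prv T (p :: map shift G) (shift q) -> prv T G q
| P_eqI G x : prv T G (Eq x x)
| P_eqE G p x y : prv T G (Eq x y) -> prv T G (inst x p) -> prv T G (inst y p).

(* The levels of the Takahashi hierarchy are closed under KP^P-provable
   equivalence.  The axioms of KP^P themselves refer to the syntactic levels,
   since the closure presupposes the theory. *)
Definition SigmaP (n : nat) (p : fml) : Prop :=
  exists q, SigmaP_syn n q /\ prv KPP [] (Iff p q).

Inductive Separation (C : fml -> Prop) : theory :=
| Sep_ax p : C p -> Separation C (ax_separation p).

(** * Structures and satisfaction *)

Record structure : Type := Structure {
  carrier :> Type;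
  mem : carrier -> carrier -> Prop
}.

Definition scons (A : Type) (a : A) (e : nat -> A) (n : nat) : A :=
  match n with 0 => a | S k => e k end.

Fixpoint sat (M : structure) (e : nat -> M) (p : fml) : Prop :=
  match p with
  | Mem x y => mem M (e x) (e y)
  | Eq x y => e x = e y
  | Bot => False
  | Imp p q => sat M e p -> sat M e q
  | And p q => sat M e p /\ sat M e q
  | Or p q => sat M e p \/ sat M e q
  | All p => forall a : M, sat M (scons a e) p
  | Ex p => exists a : M, sat M (scons a e) p
  end.

Definition models (M : structure) (T : theory) : Prop :=
  forall p, T p -> forall e : nat -> M, sat M e p.

Definition countable (M : structure) : Prop :=
  exists f : M -> nat, Injective f.

Definition nonstandard (M : structure) : Prop := ~ well_founded (mem M).

Definition substructure (M : structure) (S : M -> Prop) : structure :=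
  Structure (fun x y : {m : M | S m} => mem M (proj1_sig x) (proj1_sig y)).

Definition inclusion (M : structure) (S : M -> Prop) : substructure M S -> M :=
  @proj1_sig M S.

(** * Ordinals and rank, evaluated inside a structure *)

Section Internal.
Variable N : structure.
Local Notation "x ∈ y" := (mem N x y) (at level 70).

Definition transitive (a : N) : Prop :=
  forall x y, x ∈ a -> y ∈ x -> y ∈ a.

(* The well-foundedness of ∈ on [a] is left to the Foundation axioms of [N]. *)
Definition is_ord (a : N) : Prop :=
  transitive a /\
  forall x y, x ∈ a -> y ∈ a -> x ∈ y \/ x = y \/ y ∈ x.

Definition is_upair (p a b : N) : Prop :=
  forall w, w ∈ p <-> w = a \/ w = b.

(* Kuratowski pairs *)
Definition is_opair (p a b : N) : Prop :=
  exists s d, is_upair s a a /\ is_upair d a b /\ is_upair p s d.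

Definition maps_to (f x y : N) : Prop :=
  exists p, p ∈ f /\ is_opair p x y.

Definition is_function_on (f d : N) : Prop :=
  (forall p, p ∈ f -> exists x y, x ∈ d /\ is_opair p x y) /\
  (forall x, x ∈ d -> exists! y, maps_to f x y).

(* [f] satisfies f(x) = sup {f(y) + 1 | y ∈ x} on the transitive set [d];
   the supremum is the union of the ordinals f(y) \cup {f(y)}. *)
Definition is_rank_function (f d : N) : Prop :=
  transitive d /\ is_function_on f d /\
  forall x a, x ∈ d -> maps_to f x a ->
    forall w, w ∈ a <->
      exists y b, y ∈ x /\ maps_to f y b /\ (w ∈ b \/ w = b).

Definition has_rank (x a : N) : Prop :=
  exists f d, is_rank_function f d /\ x ∈ d /\ maps_to f x a.

Definition rank_le (x y : N) : Prop :=
  exists a b, has_rank x a /\ has_rank y b /\ (a ∈ b \/ a = b).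

(* [below_rank α x] means that x belongs to N_α. *)
Definition below_rank (alpha x : N) : Prop :=
  exists a, has_rank x a /\ a ∈ alpha.

End Internal.

(** * Embeddings *)

Section Embeddings.
Variables M N : structure.

Definition in_image (i : M -> N) (n : N) : Prop := exists m, i m = n.

Definition embedding (i : M -> N) : Prop :=
  Injective i /\ forall x y, mem M x y <-> mem N (i x) (i y).

Definition rank_initial (i : M -> N) : Prop :=
  forall m n, rank_le N n (i m) -> in_image i n.

Definition bounded (i : M -> N) : Prop :=
  exists alpha, is_ord N alpha /\ forall m, below_rank N alpha (i m).

Definition topless (i : M -> N) : Prop :=
  bounded i /\
  forall b, is_ord N b -> ~ in_image i b ->
    exists b', is_ord N b' /\ ~ in_image i b' /\ mem N b' b.

Definition rank_cut (i : M -> N) : Prop :=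
  embedding i /\ rank_initial i /\ topless i.

End Embeddings.

Definition is_rank_cut_of (M : structure) (S : M -> Prop) : Prop :=
  rank_cut (substructure M S) M (@inclusion M S).

(* Main.v *)
From Stdlib Require Import Lia Arith Classical ClassicalEpsilon FunctionalExtensionality
    PropExtensionality.
Require Import Defs.

(** The embedding is the union of a chain of finite partial maps, extended back
    and forth along an enumeration of the model, as in Friedman's embedding
    theorem.  A partial map sends some elements [a] to elements [b] of rank below
    a bound [del], and the invariant says that every type over the [a]'s realized
    anywhere in the model is realized over the [b]'s below [del].

    The types are not those of coded formulas of set theory.  They belong to an
    infinitary logic defined inside the model, whose formulas are arbitrary sets
    [z], read as conjunctions of negated clauses ([clause]); a clause is atomic,
    or a formula again, or a quantification over the sets of rank below the rank
    of a register.  Truth is defined by recursion on [z] ([true_in], [holds]), so it is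
    Delta_1, and the type of an assignment up to a level [xi] is a subset of
    [V xi] ([type_upto]).  All of that type can be written as one formula of only
    finitely many ranks more ([char_code]).  Hence, if two assignments agree up to
    a level slightly above [xi], then each change of a register of the first to a
    set of rank below that of some register is answered by a change of the second,
    bounded likewise, that restores agreement up to [xi] ([agree_move]).  Every move costs a few ranks of agreement, but the ordinals
    outside the cut have no least element, so there is always a lower level
    outside the cut to continue with; agreement up to any such level fixes the
    elements of the cut.  This descent takes the place of overspill.

    The types up to [xi] realized in the model form a set by
    Sigma_1^P-Separation, and Collection yields a set of realizations
    ([complete_ex]).  Putting such a complete level into a register turns the
    unbounded quantifier of the invariant [good] into a bounded one, to which
    [agree_move] applies.  This gives the steps of the construction: a new element
    below a recorded level can be matched on either side ([good_both]), which
    makes the embedding total and rank-initial; recorded levels can be raised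
    ([good_raise]); the bound can be lowered ([good_lower]).  The image is
    topless because the level answering a complete level is itself an admissible
    bound: given [d], either some admissible bound is below [d], or the next
    recorded level exceeds [d] ([topless_dense]).  Finally, for [al] outside the
    cut, Cantor's theorem gives two elements of rank [al] with the same type up
    to a level outside the cut and below [al]; if an answer to the first is the
    first itself, it is also an answer to the second ([good_moved]).

    To use the axiom schemes without writing formulas, predicates are ordinary
    propositions about elements of the model, and definability is a property of
    predicates ([Delta0], [Sigma1], [Delta1]) and of functions ([Dfun]) with closure lemmas
    that the tactic [definable] chains. *)

Section Model.
Variable M : structure.
Hypothesis hKPP : models M KPP.
Hypothesis hSep : models M (Separation (SigmaP 1)).
Variable m0 : M.

(** * Definability by bounded formulas *)

Notation env := (nat -> M).
Notation "x '∈' y" := (mem M x y) (at level 70, no associativity).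
Notation "x '⊑' y" := (forall z, z ∈ x -> z ∈ y) (at level 70, no associativity).

Lemma sat_ren : forall p (e : env) r,
  sat M e (ren r p) <-> sat M (fun n => e (r n)) p.
Proof.
  assert (U : forall (e : env) r a,
    (fun n => scons a e (up r n)) = scons a (fun n => e (r n))).
  { intros e r a. apply functional_extensionality. intros [|n]; reflexivity. }
  induction p; intros e r; simpl; try tauto.
  1-3: rewrite IHp1, IHp2; tauto.
  - split; intros H a; specialize (H a); [rewrite IHp, U in H | rewrite IHp, U]; exact H.
  - split; intros [a H]; exists a; [rewrite IHp, U in H | rewrite IHp, U]; exact H.
Qed.

Lemma Delta0P_ren : forall p, Delta0P p -> forall r, Delta0P (ren r p).
Proof.
  induction 1; intros r; simpl; try (constructor; auto; fail).
Qed.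

Definition interleave (A : Type) (f g : nat -> A) (n : nat) : A :=
  if Nat.even n then f (Nat.div2 n) else g (Nat.div2 n).

Lemma interleave_even A (f g : nat -> A) k : interleave A f g (2 * k) = f k.
Proof.
  unfold interleave. rewrite Nat.div2_double.
  replace (Nat.even (2 * k)) with true; [reflexivity|].
  symmetry. apply Nat.even_spec. exists k; reflexivity.
Qed.

Lemma interleave_odd A (f g : nat -> A) k : interleave A f g (S (2 * k)) = g k.
Proof.
  unfold interleave. rewrite Nat.div2_succ_double.
  replace (Nat.even (S (2 * k))) with false; [reflexivity|].
  rewrite Nat.even_succ, <- Nat.negb_even.
  replace (Nat.even (2 * k)) with true; [reflexivity|].
  symmetry. apply Nat.even_spec. exists k; reflexivity.
Qed.

(** Interleaving a valuation with a sequence of parameters lets definable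
    predicates carry elements of the model as constants without any
    bookkeeping of which variables true_in them. *)
Definition mix : env -> env -> env := interleave M.
Definition parity : (nat -> nat) -> (nat -> nat) -> nat -> nat := interleave nat.

Lemma mix_even e c k : mix e c (2 * k) = e k.
Proof. apply interleave_even. Qed.
Lemma mix_odd e c k : mix e c (S (2 * k)) = c k.
Proof. apply interleave_odd. Qed.

Definition Delta0 (P : env -> Prop) : Prop :=
  exists p c, Delta0P p /\ forall e, sat M (mix e c) p <-> P e.

Lemma mix_reindex (e c : env) (E : env) f g :
  (forall k, e k = E (f k)) -> (forall k, c k = E (g k)) ->
  mix e c = fun n => E (parity f g n).
Proof.
  intros H1 H2. apply functional_extensionality. intros n. unfold mix, parity.
  destruct (Nat.Even_or_Odd n) as [[k ->]|[k ->]].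
  - rewrite !interleave_even. apply H1.
  - rewrite Nat.add_1_r, !interleave_odd. apply H2.
Qed.

Definition scons_index : nat -> nat :=
  parity (fun k => match k with 0 => 0 | S k => S (2 * k) end)
         (fun k => S (S (2 * k))).

Lemma mix_scons x e c : mix (scons x e) c = fun n => scons x (mix e c) (scons_index n).
Proof.
  apply mix_reindex; intros k.
  - destruct k; cbn [scons]; [reflexivity|]. now rewrite mix_even.
  - cbn [scons]. now rewrite mix_odd.
Qed.

Lemma Delta0_ext P Q : Delta0 P -> (forall e, P e <-> Q e) -> Delta0 Q.
Proof.
  intros (p & c & Hp & H) E. exists p, c. split; auto.
  intros e. rewrite H. apply E.
Qed.

Lemma Delta0_bin (o : fml -> fml -> fml) (O : Prop -> Prop -> Prop) :
  (forall p q, Delta0P p -> Delta0P q -> Delta0P (o p q)) ->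
  (forall e p q, sat M e (o p q) <-> O (sat M e p) (sat M e q)) ->
  forall P Q, Delta0 P -> Delta0 Q -> Delta0 (fun e => O (P e) (Q e)).
Proof.
  intros Ho HO P Q (p & c & Hp & H) (q & d & Hq & K).
  exists (o (ren (parity (fun k => 2 * k) (fun k => S (2 * (2 * k)))) p)
            (ren (parity (fun k => 2 * k) (fun k => S (2 * (S (2 * k))))) q)).
  exists (mix c d). split.
  { apply Ho; apply Delta0P_ren; assumption. }
  intros e. rewrite HO.
  assert (E1 : sat M (mix e (mix c d))
    (ren (parity (fun k => 2 * k) (fun k => S (2 * (2 * k)))) p) = P e).
  { apply propositional_extensionality. rewrite sat_ren, <- (mix_reindex e c).
    - apply H.
    - intros k. now rewrite mix_even.
    - intros k. now rewrite mix_odd, mix_even. }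
  assert (E2 : sat M (mix e (mix c d))
    (ren (parity (fun k => 2 * k) (fun k => S (2 * (S (2 * k))))) q) = Q e).
  { apply propositional_extensionality. rewrite sat_ren, <- (mix_reindex e d).
    - apply K.
    - intros k. now rewrite mix_even.
    - intros k. now rewrite mix_odd, mix_odd. }
  rewrite E1, E2. tauto.
Qed.

Lemma Delta0_and P Q : Delta0 P -> Delta0 Q -> Delta0 (fun e => P e /\ Q e).
Proof. apply (@Delta0_bin And and D_And). simpl; tauto. Qed.
Lemma Delta0_or P Q : Delta0 P -> Delta0 Q -> Delta0 (fun e => P e \/ Q e).
Proof. apply (@Delta0_bin Or or D_Or). simpl; tauto. Qed.
Lemma Delta0_imp P Q : Delta0 P -> Delta0 Q -> Delta0 (fun e => P e -> Q e).
Proof. apply (@Delta0_bin Imp (fun A B => A -> B) D_Imp). simpl; tauto. Qed.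
Lemma Delta0_bot : Delta0 (fun _ => False).
Proof. exists Bot, (fun _ => m0). split; [constructor | simpl; tauto]. Qed.
Lemma Delta0_not P : Delta0 P -> Delta0 (fun e => ~ P e).
Proof. intros H. apply (@Delta0_imp P _ H Delta0_bot). Qed.
Lemma Delta0_mem i j : Delta0 (fun e => e i ∈ e j).
Proof.
  exists (Mem (2 * i) (2 * j)), (fun _ => m0). split; [constructor|].
  intros e. cbn [sat]. rewrite !mix_even. tauto.
Qed.
Lemma Delta0_eq i j : Delta0 (fun e => e i = e j).
Proof.
  exists (Eq (2 * i) (2 * j)), (fun _ => m0). split; [constructor|].
  intros e. cbn [sat]. rewrite !mix_even. tauto.
Qed.
Lemma Delta0_eq_const i m : Delta0 (fun e => e i = m).
Proof.
  exists (Eq (2 * i) (S (2 * 0))), (fun _ => m). split; [constructor|].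
  intros e. cbn [sat]. rewrite mix_even, mix_odd. tauto.
Qed.

Lemma Delta0_ren r P : Delta0 P -> Delta0 (fun e => P (fun n => e (r n))).
Proof.
  intros (p & c & Hp & H).
  exists (ren (parity (fun k => 2 * r k) (fun k => S (2 * k))) p), c.
  split; [now apply Delta0P_ren|].
  intros e. rewrite sat_ren, <- (mix_reindex (fun n => e (r n)) c).
  - apply H.
  - intros k. now rewrite mix_even.
  - intros k. now rewrite mix_odd.
Qed.

(** The axiom schemes read their leading variables outside of the interleaving. *)
Lemma Delta0_fml1 P : Delta0 P -> exists p c, Delta0P p /\
  forall x e, sat M (scons x (mix e c)) p <-> P (scons x e).
Proof.
  intros (p & c & Hp & H). exists (ren scons_index p), c.
  split; [now apply Delta0P_ren|].
  intros x e. rewrite sat_ren, <- mix_scons. apply H.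
Qed.

Lemma scons_up x (e : env) r :
  (fun n => scons x e (up r n)) = scons x (fun n => e (r n)).
Proof. apply functional_extensionality. intros [|n]; reflexivity. Qed.

Lemma Delta0_fml2 P : Delta0 P -> exists p c, Delta0P p /\
  forall x y e, sat M (scons x (scons y (mix e c))) p <-> P (scons x (scons y e)).
Proof.
  intros (p & c & Hp & H)%Delta0_fml1. exists (ren (up scons_index) p), c.
  split; [now apply Delta0P_ren|].
  intros x y e. rewrite sat_ren, scons_up, <- mix_scons. apply H.
Qed.

Lemma Delta0_allin j P : Delta0 P -> Delta0 (fun e => forall x, x ∈ e j -> P (scons x e)).
Proof.
  intros (p & c & Hp & H)%Delta0_fml1. exists (AllIn (2 * j) p), c.
  split; [now constructor|].
  intros e. cbn -[Nat.mul]. rewrite mix_even.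
  split; intros K x Hx; apply H; auto.
Qed.

Lemma Delta0_exin j P : Delta0 P -> Delta0 (fun e => exists x, x ∈ e j /\ P (scons x e)).
Proof.
  intros (p & c & Hp & H)%Delta0_fml1. exists (ExIn (2 * j) p), c.
  split; [now constructor|].
  intros e. cbn -[Nat.mul]. rewrite mix_even.
  split; intros (x & Hx & K); exists x; split; auto; apply H; auto.
Qed.

Lemma Delta0_allsub j P : Delta0 P -> Delta0 (fun e => forall x, x ⊑ e j -> P (scons x e)).
Proof.
  intros (p & c & Hp & H)%Delta0_fml1. exists (AllSub (2 * j) p), c.
  split; [now constructor|].
  intros e. cbn -[Nat.mul]. rewrite mix_even.
  split; intros K x Hx; apply H; auto.
Qed.

(** ** The axioms as statements about elements *)

Lemma set_ext x y : (forall z, z ∈ x <-> z ∈ y) -> x = y.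
Proof.
  intros H. exact (hKPP _ KPP_extensionality (fun _ => m0) x y H).
Qed.

Lemma pair_ex a b : exists c, forall x, x ∈ c <-> x = a \/ x = b.
Proof. exact (hKPP _ KPP_pair (fun _ => m0) a b). Qed.

Lemma union_ex a : exists b, forall x, x ∈ b <-> exists y, y ∈ a /\ x ∈ y.
Proof. exact (hKPP _ KPP_union (fun _ => m0) a). Qed.

Lemma pow_ex a : exists b, forall x, x ∈ b <-> x ⊑ a.
Proof. exact (hKPP _ KPP_powerset (fun _ => m0) a). Qed.

Lemma collection_Delta0 P (e : env) a : Delta0 P ->
  (forall u, u ∈ a -> exists v, P (scons v (scons u e))) ->
  exists b, forall u, u ∈ a -> exists v, v ∈ b /\ P (scons v (scons u e)).
Proof.
  intros (p & c & Hp & H)%Delta0_fml2 Hu.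
  destruct (hKPP _ (KPP_collection Hp) (mix e c) a) as [b Hb].
  - intros u Hua. destruct (Hu u Hua) as [v Hv]. exists v.
    rewrite sat_ren, !scons_up. cbn.
    replace (fun n => scons a (mix e c) (n + 1)) with (mix e c); [now apply H|].
    apply functional_extensionality. intros n. now rewrite Nat.add_1_r.
  - exists b. intros u Hua. destruct (Hb u Hua) as (v & Hv & K). exists v.
    split; auto. rewrite sat_ren, !scons_up in K. cbn in K.
    apply H. replace (mix e c) with (fun n => scons b (scons a (mix e c)) (n + 2)); auto.
    apply functional_extensionality. intros n.
    now replace (n + 2) with (S (S n)) by lia.
Qed.

(** The semantic forms of Sigma_1^P and of Delta_1^P. *)
Definition Sigma1 (P : env -> Prop) : Prop :=
  exists Q, Delta0 Q /\ forall e, P e <-> exists w, Q (scons w e).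
Definition Delta1 (P : env -> Prop) : Prop := Sigma1 P /\ Sigma1 (fun e => ~ P e).

(** A function is definable when its graph is; being total, it may then be
    substituted into both kinds of predicate. *)
Definition Dfun (f : env -> M) : Prop := Sigma1 (fun e => e 0 = f (fun n => e (S n))).

Lemma Sigma1_ext P Q : Sigma1 P -> (forall e, P e <-> Q e) -> Sigma1 Q.
Proof.
  intros (R & HR & H) E. exists R. split; auto.
  intros e. rewrite <- E. apply H.
Qed.

Lemma Delta0_tail P : Delta0 P -> Delta0 (fun e => P (fun n => e (S n))).
Proof. apply (Delta0_ren S). Qed.

Lemma Delta0_Sigma1 P : Delta0 P -> Sigma1 P.
Proof.
  intros H. exists (fun e => P (fun n => e (S n))). split; [now apply Delta0_tail|].
  intros e. split; [intros K; exists m0; exact K | intros [w K]; exact K].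
Qed.

Lemma Delta0_Delta1 P : Delta0 P -> Delta1 P.
Proof. intros H. split; apply Delta0_Sigma1; auto. now apply Delta0_not. Qed.

Lemma Sigma1_ren r P : Sigma1 P -> Sigma1 (fun e => P (fun n => e (r n))).
Proof.
  intros (Q & HQ & H). exists (fun e => Q (fun n => e (up r n))).
  split; [now apply (Delta0_ren (up r))|].
  intros e. rewrite H. now setoid_rewrite scons_up.
Qed.

Lemma env_eta (e e' : env) : (forall n, e n = e' n) -> e = e'.
Proof. apply functional_extensionality. Qed.

(** Two existential quantifiers contract to one: a single witness contains both
    as elements. *)
Lemma pair_bound P : Delta0 P ->
  Sigma1 (fun e => exists v w, P (scons v (scons w e))).
Proof.
  intros H. exists (fun e => exists v, v ∈ e 0 /\ exists w, w ∈ e 0 /\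
    P (scons v (scons w (fun n => e (S n))))). split.
  - pose (r := fun n => match n with 0 => 1 | 1 => 0 | S (S n) => S (S (S n)) end).
    pose proof (Delta0_exin 0 _ (Delta0_exin 1 _ (Delta0_ren r _ H))) as K.
    apply (Delta0_ext _ _ K). intros e. cbn.
    split; intros (v & Hv & w & Hw & L); exists v; split; auto; exists w; split; auto;
    (match goal with L : P ?a |- P ?b => replace b with a; auto end);
    apply env_eta; intros [|[|n]]; reflexivity.
  - intros e. split.
    + intros (v & w & K). destruct (pair_ex v w) as [c Hc]. exists c. cbn.
      exists v. split; [apply Hc; auto|]. exists w. split; [apply Hc; auto|]. exact K.
    + intros (c & v & _ & w & _ & K). exists v, w. exact K.
Qed.

Lemma Sigma1_ex P : Sigma1 P -> Sigma1 (fun e => exists x, P (scons x e)).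
Proof.
  intros (Q & HQ & H). eapply Sigma1_ext; [apply (pair_bound _ HQ)|].
  intros e. cbn. setoid_rewrite H. firstorder.
Qed.

Lemma Sigma1_and P Q : Sigma1 P -> Sigma1 Q -> Sigma1 (fun e => P e /\ Q e).
Proof.
  intros (P' & HP & H) (Q' & HQ & K).
  eapply Sigma1_ext.
  - apply (pair_bound (fun e => P' (scons (e 0) (fun n => e (S (S n)))) /\
                                Q' (scons (e 1) (fun n => e (S (S n)))))).
    apply Delta0_and.
    + apply (Delta0_ext (fun e => P' (fun n => e (match n with 0 => 0 | S n => S (S n) end)))).
      * apply (Delta0_ren _ _ HP).
      * intros e. match goal with |- P' ?a <-> P' ?b => replace b with a; [tauto|] end.
        apply env_eta; intros [|n]; reflexivity.
    + apply (Delta0_ext (fun e => Q' (fun n => e (match n with 0 => 1 | S n => S (S n) end)))).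
      * apply (Delta0_ren _ _ HQ).
      * intros e. match goal with |- Q' ?a <-> Q' ?b => replace b with a; [tauto|] end.
        apply env_eta; intros [|n]; reflexivity.
  - intros e. cbn. rewrite H, K. firstorder.
Qed.

Lemma Sigma1_or P Q : Sigma1 P -> Sigma1 Q -> Sigma1 (fun e => P e \/ Q e).
Proof.
  intros (P' & HP & H) (Q' & HQ & K).
  exists (fun e => P' e \/ Q' e). split; [now apply Delta0_or|].
  intros e. rewrite H, K. firstorder.
Qed.

(** Collection bounds the witnesses for all elements at once. *)
Lemma Sigma1_allin j P : Sigma1 P -> Sigma1 (fun e => forall x, x ∈ e j -> P (scons x e)).
Proof.
  intros (Q & HQ & H).
  exists (fun e => forall x, x ∈ e (S j) -> exists v, v ∈ e 0 /\
     Q (scons v (scons x (fun n => e (S n))))). split.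
  - pose (r := fun n => match n with 0 => 0 | 1 => 1 | S (S n) => S (S (S n)) end).
    apply (Delta0_ext _ _ (Delta0_allin (S j) _ (Delta0_exin 1 _ (Delta0_ren r _ HQ)))).
    intros e. cbn.
    split; intros K x Hx; destruct (K x Hx) as (v & Hv & L); exists v; split; auto;
    (match goal with L : Q ?a |- Q ?b => replace b with a; auto end);
    apply env_eta; intros [|[|n]]; reflexivity.
  - intros e. cbn. split.
    + intros K. destruct (collection_Delta0 Q e (e j) HQ) as [b Hb].
      { intros u Hu. apply H. auto. }
      exists b. exact Hb.
    + intros (b & K) x Hx. apply H. destruct (K x Hx) as (v & _ & L). exists v. exact L.
Qed.

(** ** Closure properties of definability *)

Lemma Sigma1_ex' (Q : M -> env -> Prop) :
  Sigma1 (fun e => Q (e 0) (fun n => e (S n))) -> Sigma1 (fun e => exists x, Q x e).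
Proof. apply (@Sigma1_ex (fun e => Q (e 0) (fun n => e (S n)))). Qed.

Lemma Dfun_var n : Dfun (fun e => e n).
Proof. apply Delta0_Sigma1, (Delta0_eq 0 (S n)). Qed.

Lemma Dfun_const m : Dfun (fun _ => m).
Proof. apply Delta0_Sigma1, (Delta0_eq_const 0 m). Qed.

(** Substituting a function keeps both a predicate and its negation
    existential, since the value is named by an existential quantifier. *)
Lemma Sigma1_subst (Q : M -> env -> Prop) f : Dfun f ->
  Sigma1 (fun e => Q (e 0) (fun n => e (S n))) -> Sigma1 (fun e => Q (f e) e).
Proof.
  intros Hf HQ. pose proof (Sigma1_ex _ (Sigma1_and _ _ Hf HQ)) as K.
  apply (Sigma1_ext _ _ K). intros e. cbn.
  split; [intros (x & -> & L); exact L | intros L; exists (f e); auto].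
Qed.

Lemma Delta1_subst (Q : M -> env -> Prop) f : Dfun f ->
  Delta1 (fun e => Q (e 0) (fun n => e (S n))) -> Delta1 (fun e => Q (f e) e).
Proof.
  intros Hf [H1 H2]. split; [apply (Sigma1_subst Q f Hf H1)|].
  apply (Sigma1_subst (fun x e => ~ Q x e) f Hf H2).
Qed.

Lemma Dfun_tail f : Dfun f -> Dfun (fun e => f (fun n => e (S n))).
Proof. apply (Sigma1_ren (fun n => match n with 0 => 0 | S n => S (S n) end)). Qed.

Lemma Sigma1_subst2 (Q : M -> M -> Prop) f g : Dfun f -> Dfun g ->
  Sigma1 (fun e => Q (e 0) (e 1)) -> Sigma1 (fun e => Q (f e) (g e)).
Proof.
  intros Hf Hg HQ. apply (Sigma1_subst (fun x e => Q x (g e)) f Hf).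
  apply (Sigma1_subst (fun y e => Q (e 0) y) _ (Dfun_tail g Hg)).
  apply (Sigma1_ren (fun n => match n with 0 => 1 | 1 => 0 | n => n end) _ HQ).
Qed.

Lemma Delta1_subst2 (Q : M -> M -> Prop) f g : Dfun f -> Dfun g ->
  Delta1 (fun e => Q (e 0) (e 1)) -> Delta1 (fun e => Q (f e) (g e)).
Proof.
  intros Hf Hg [H1 H2]. split; [now apply Sigma1_subst2|].
  now apply (Sigma1_subst2 (fun x y => ~ Q x y)).
Qed.

Lemma Sigma1_subst3 (Q : M -> M -> M -> Prop) f g h : Dfun f -> Dfun g -> Dfun h ->
  Sigma1 (fun e => Q (e 0) (e 1) (e 2)) -> Sigma1 (fun e => Q (f e) (g e) (h e)).
Proof.
  intros Hf Hg Hh HQ. apply (Sigma1_subst (fun x e => Q x (g e) (h e)) f Hf).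
  apply (Sigma1_subst (fun y e => Q (e 0) y (h (fun n => e (S n)))) _ (Dfun_tail g Hg)).
  apply (Sigma1_subst (fun z e => Q (e 1) (e 0) z) _ (Dfun_tail _ (Dfun_tail h Hh))).
  apply (Sigma1_ren (fun n => match n with 0 => 2 | 1 => 1 | 2 => 0 | n => n end) _ HQ).
Qed.

Lemma Delta1_subst3 (Q : M -> M -> M -> Prop) f g h : Dfun f -> Dfun g -> Dfun h ->
  Delta1 (fun e => Q (e 0) (e 1) (e 2)) -> Delta1 (fun e => Q (f e) (g e) (h e)).
Proof.
  intros Hf Hg Hh [H1 H2]. split; [now apply Sigma1_subst3|].
  now apply (Sigma1_subst3 (fun x y z => ~ Q x y z)).
Qed.

Lemma Dfun_app1 (F : M -> M) f :
  Sigma1 (fun e => e 0 = F (e 1)) -> Dfun f -> Dfun (fun e => F (f e)).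
Proof.
  intros HF Hf. apply (Sigma1_subst2 (fun x y => x = F y) (fun e => e 0)); auto.
  - apply Dfun_var.
  - now apply Dfun_tail.
Qed.

Lemma Dfun_app2 (F : M -> M -> M) f g :
  Sigma1 (fun e => e 0 = F (e 1) (e 2)) -> Dfun f -> Dfun g -> Dfun (fun e => F (f e) (g e)).
Proof.
  intros HF Hf Hg. apply (Sigma1_subst3 (fun x y z => x = F y z) (fun e => e 0)); auto.
  - apply Dfun_var.
  - now apply Dfun_tail.
  - now apply Dfun_tail.
Qed.

Lemma Dfun_app3 (F : M -> M -> M -> M) f g h :
  Sigma1 (fun e => e 0 = F (e 1) (e 2) (e 3)) -> Dfun f -> Dfun g -> Dfun h ->
  Dfun (fun e => F (f e) (g e) (h e)).
Proof.
  intros HF Hf Hg Hh.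
  apply (Sigma1_subst (fun x e => e 0 = F (f (fun n => e (S n))) (g (fun n => e (S n))) x)
           (fun e => h (fun n => e (S n))) (Dfun_tail _ Hh)).
  apply (Sigma1_subst (fun x e => e 1 = F (f (fun n => e (S (S n)))) x (e 0))
           (fun e => g (fun n => e (S (S n)))) (Dfun_tail _ (Dfun_tail _ Hg))).
  apply (Sigma1_subst (fun x e => e 2 = F x (e 0) (e 1))
           (fun e => f (fun n => e (S (S (S n))))) (Dfun_tail _ (Dfun_tail _ (Dfun_tail _
               Hf)))).
  apply (Sigma1_ren (fun n => match n with 0 => 3 | 1 => 0 | 2 => 1 | 3 => 2 | n => n end) _
      HF).
Qed.

Lemma Delta1_mem f g : Dfun f -> Dfun g -> Delta1 (fun e => f e ∈ g e).
Proof.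
  intros. apply (Delta1_subst2 (fun x y => x ∈ y)); auto. apply Delta0_Delta1, Delta0_mem.
Qed.
Lemma Delta1_eq f g : Dfun f -> Dfun g -> Delta1 (fun e => f e = g e).
Proof.
  intros. apply (Delta1_subst2 (fun x y => x = y)); auto. apply Delta0_Delta1, Delta0_eq.
Qed.
Lemma Delta1_not P : Delta1 P -> Delta1 (fun e => ~ P e).
Proof.
  intros [H1 H2]. split; auto. apply (Sigma1_ext _ _ H1). intros e. tauto.
Qed.
Lemma Delta1_and P Q : Delta1 P -> Delta1 Q -> Delta1 (fun e => P e /\ Q e).
Proof.
  intros [H1 H2] [K1 K2]. split; [now apply Sigma1_and|].
  apply (Sigma1_ext _ _ (Sigma1_or _ _ H2 K2)). intros e. tauto.
Qed.
Lemma Delta1_or P Q : Delta1 P -> Delta1 Q -> Delta1 (fun e => P e \/ Q e).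
Proof.
  intros [H1 H2] [K1 K2]. split; [now apply Sigma1_or|].
  apply (Sigma1_ext _ _ (Sigma1_and _ _ H2 K2)). intros e. tauto.
Qed.
Lemma Delta1_imp P Q : Delta1 P -> Delta1 Q -> Delta1 (fun e => P e -> Q e).
Proof.
  intros [H1 H2] [K1 K2]. split.
  - apply (Sigma1_ext _ _ (Sigma1_or _ _ H2 K1)). intros e. tauto.
  - apply (Sigma1_ext _ _ (Sigma1_and _ _ H1 K2)). intros e. tauto.
Qed.
Lemma Delta1_iff P Q : Delta1 P -> Delta1 Q -> Delta1 (fun e => P e <-> Q e).
Proof. intros. apply Delta1_and; apply Delta1_imp; auto. Qed.

Lemma Sigma1_all g (Q : M -> env -> Prop) : Dfun g ->
  Sigma1 (fun e => Q (e 0) (fun n => e (S n))) -> Sigma1 (fun e => forall x, x ∈ g e -> Q x e).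
Proof.
  intros Hg HQ.
  apply (Sigma1_subst (fun y e => forall x, x ∈ y -> Q x e) g Hg).
  apply (Sigma1_allin 0 (fun e => Q (e 0) (fun n => e (S (S n))))).
  apply (Sigma1_ren (fun n => match n with 0 => 0 | S n => S (S n) end) _ HQ).
Qed.

Lemma Sigma1_exb g (Q : M -> env -> Prop) : Dfun g ->
  Sigma1 (fun e => Q (e 0) (fun n => e (S n))) -> Sigma1 (fun e => exists x, x ∈ g e /\ Q x e).
Proof.
  intros Hg HQ. apply Sigma1_ex'. apply Sigma1_and; auto.
  apply Delta1_mem; [apply Dfun_var | now apply Dfun_tail].
Qed.

Lemma Delta1_all g (Q : M -> env -> Prop) : Dfun g ->
  Delta1 (fun e => Q (e 0) (fun n => e (S n))) -> Delta1 (fun e => forall x, x ∈ g e -> Q x e).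
Proof.
  intros Hg [H1 H2]. split; [now apply Sigma1_all|].
  apply (Sigma1_ext _ _ (Sigma1_exb g (fun x e => ~ Q x e) Hg H2)).
  intros e. split.
  - intros (x & Hx & K) L. auto.
  - intros K. apply NNPP. intros L. apply K. intros x Hx. apply NNPP.
    intros N. apply L. exists x. auto.
Qed.

Lemma Delta1_exb g (Q : M -> env -> Prop) : Dfun g ->
  Delta1 (fun e => Q (e 0) (fun n => e (S n))) -> Delta1 (fun e => exists x, x ∈ g e /\ Q x e).
Proof.
  intros Hg [H1 H2]. split; [now apply Sigma1_exb|].
  apply (Sigma1_ext _ _ (Sigma1_all g (fun x e => ~ Q x e) Hg H2)).
  intros e. firstorder.
Qed.

(** ** Separation, collection and induction for existential predicates *)

Lemma prv_iff_refl T p : prv T nil (Iff p p).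
Proof. apply P_andI; apply P_impI, P_hyp; left; reflexivity. Qed.

Lemma separation_Sigma1 (Q : M -> Prop) a : Sigma1 (fun e => Q (e 0)) ->
  exists b, forall x, x ∈ b <-> x ∈ a /\ Q x.
Proof.
  intros (R & (p & c & Hp & H)%Delta0_fml2 & HR).
  pose (e := fun _ : nat => m0).
  assert (HS : SigmaP 1 (Ex p)).
  { exists (Ex p). split; [exists p; auto | apply prv_iff_refl]. }
  destruct (hSep _ (@Sep_ax (SigmaP 1) _ HS) (mix e c) a) as [b Hb].
  exists b. intros x.
  assert (Hx : x ∈ b <-> x ∈ a /\ exists w,
    sat M (scons w (scons x (scons b (scons a (mix e c)))))
      (ren (up (up (fun k => k + 2))) p)) by exact (Hb x).
  rewrite Hx. apply and_iff_compat_l.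
  transitivity (exists w, R (scons w (scons x e))).
  - split; intros [w K]; exists w.
    + apply H. rewrite sat_ren, !scons_up in K. cbn in K.
      replace (fun n => scons b (scons a (mix e c)) (n + 2)) with (mix e c) in K; auto.
      apply env_eta. intros n. now replace (n + 2) with (S (S n)) by lia.
    + rewrite sat_ren, !scons_up. cbn.
      replace (fun n => scons b (scons a (mix e c)) (n + 2)) with (mix e c); [now apply H|].
      apply env_eta. intros n. now replace (n + 2) with (S (S n)) by lia.
  - symmetry. apply (HR (scons x e)).
Qed.

Lemma collection_Sigma1 (Q : M -> M -> Prop) a : Sigma1 (fun e => Q (e 0) (e 1)) ->
  (forall x, x ∈ a -> exists y, Q x y) ->
  exists b, forall x, x ∈ a -> exists y, y ∈ b /\ Q x y.
Proof.
  intros (R & HR & H) HQ. pose (e := fun _ : nat => m0).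
  pose (P := fun e : env => exists y, y ∈ e 0 /\ exists w, w ∈ e 0 /\
    R (scons w (scons (e 1) (scons y (fun n => e (S (S n))))))).
  destruct (collection_Delta0 P e a) as [b Hb].
  - pose (r := fun n => match n with 0 => 0 | 1 => 3 | 2 => 1
                                  | S (S (S n)) => S (S (S (S n))) end).
    apply (Delta0_ext _ _ (Delta0_exin 0 _ (Delta0_exin 1 _ (Delta0_ren r _ HR)))).
    intros d. unfold P. cbn.
    split; intros (v & Hv & w & Hw & L); exists v; split; auto; exists w; split; auto;
    (match goal with L : R ?a |- R ?b => replace b with a; auto end);
    apply env_eta; intros [|[|[|n]]]; reflexivity.
  - intros x Hx. destruct (HQ x Hx) as [y Hy].
    destruct (proj1 (H (scons x (scons y e))) Hy) as [w Hw].
    destruct (pair_ex y w) as [v Hv]. exists v. exists y. split; [apply Hv; auto|].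
    exists w. split; [apply Hv; auto|]. exact Hw.
  - destruct (union_ex b) as [c Hc]. exists c. intros x Hx.
    destruct (Hb x Hx) as (v & Hv & y & Hy & w & _ & K). exists y. split.
    + apply Hc. exists v. auto.
    + apply (H (scons x (scons y e))). exists w. exact K.
Qed.

(** Foundation applies to the complement, which is universal. *)
Lemma ind_Sigma1 (P : M -> Prop) : Sigma1 (fun e => P (e 0)) ->
  (forall x, (forall y, y ∈ x -> P y) -> P x) -> forall x, P x.
Proof.
  intros (R & HR & H) IH x. pose (e := fun _ : nat => m0).
  destruct (Delta0_fml2 _ (Delta0_not _ HR)) as (p & c & Hp & K).
  assert (E : forall y, sat M (scons y (mix e c)) (All p) <-> ~ P y).
  { intros y. cbn. setoid_rewrite K. split.
    - intros L N. apply (H (scons y e)) in N. destruct N as [w N]. exact (L w N).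
    - intros L w N. apply L. apply (H (scons y e)). exists w. exact N. }
  apply NNPP. intros Hx.
  assert (HP : PiP_syn 1 (All p)) by (exists p; auto).
  destruct (hKPP _ (@KPP_foundation (All p) HP) (mix e c)) as (y & Hy & L).
  { exists x. apply E. exact Hx. }
  apply E in Hy. apply Hy, IH. intros z Hz.
  assert (N : ~ sat M (scons z (scons y (mix e c))) (ren (up (fun k => k + 1)) (All p)))
    by exact (L z Hz).
  rewrite sat_ren, scons_up in N.
  replace (fun n => scons y (mix e c) (n + 1)) with (mix e c) in N.
  - apply NNPP. intros K'. apply N, E, K'.
  - apply env_eta. intros n. now rewrite Nat.add_1_r.
Qed.

(** * Set-theoretic operations *)

Lemma Delta1_Sigma1 P : Delta1 P -> Sigma1 P.
Proof. intros [H _]. exact H. Qed.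

Create HintDb definable discriminated.
Hint Constants Opaque : definable.
Hint Variables Opaque : definable.
Hint Resolve Dfun_var Dfun_const Delta1_mem Delta1_eq Delta1_not Delta1_and Delta1_or
    Delta1_imp Delta1_iff
  Delta1_all Delta1_exb : definable.
Hint Resolve Sigma1_and Sigma1_or Sigma1_all Sigma1_exb Sigma1_ex' | 5 : definable.
Hint Resolve Delta1_Sigma1 | 1 : definable.
Ltac definable := cbn beta; solve [auto 60 with definable nocore].

Lemma Delta1_app1 (Q : M -> Prop) f : Delta1 (fun e => Q (e 0)) -> Dfun f ->
    Delta1 (fun e => Q (f e)).
Proof.
  intros HQ Hf. apply (Delta1_subst (fun x _ => Q x) f Hf HQ).
Qed.

(** Separation and Replacement need a predicate of one variable; the rest of the
    valuation, infinite as it is, moves into the parameters. *)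
Lemma Sigma1_close (Q : M -> env -> Prop) (e0 : env) :
  Sigma1 (fun e => Q (e 0) (fun n => e (S n))) -> Sigma1 (fun e => Q (e 0) e0).
Proof.
  intros (R & (p & c & Hp & H) & HR).
  exists (fun e => R (scons (e 0) (scons (e 1) e0))). split.
  - pose (f := fun k => match k with 0 => 0 | 1 => 2 | S (S k) => S (2 * (2 * k)) end).
    exists (ren (parity f (fun k => S (2 * (S (2 * k))))) p), (mix e0 c).
    split; [now apply Delta0P_ren|].
    intros e. rewrite sat_ren.
    rewrite <- (mix_reindex (scons (e 0) (scons (e 1) e0)) c (mix e (mix e0 c))).
    + apply H.
    + intros [|[|k]]; cbn [scons f].
      * apply (mix_even e (mix e0 c) 0).
      * apply (mix_even e (mix e0 c) 1).
      * now rewrite mix_odd, mix_even.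
    + intros k. now rewrite mix_odd, mix_odd.
  - intros e. apply (HR (scons (e 0) e0)).
Qed.

Lemma Delta1_close (Q : M -> env -> Prop) (e0 : env) :
  Delta1 (fun e => Q (e 0) (fun n => e (S n))) -> Delta1 (fun e => Q (e 0) e0).
Proof.
  intros [H K]. split; [now apply Sigma1_close | now apply (Sigma1_close (fun x e => ~ Q x e))].
Qed.

Lemma Sigma1_close2 (Q : M -> M -> env -> Prop) (e0 : env) :
  Sigma1 (fun e => Q (e 0) (e 1) (fun n => e (S (S n)))) -> Sigma1 (fun e => Q (e 0) (e 1) e0).
Proof.
  intros (R & (p & c & Hp & H) & HR).
  exists (fun e => R (scons (e 0) (scons (e 1) (scons (e 2) e0)))). split.
  - pose (f := fun k => match k with 0 => 0 | 1 => 2 | 2 => 4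
                                 | S (S (S k)) => S (2 * (2 * k)) end).
    exists (ren (parity f (fun k => S (2 * (S (2 * k))))) p), (mix e0 c).
    split; [now apply Delta0P_ren|].
    intros e. rewrite sat_ren.
    rewrite <- (mix_reindex (scons (e 0) (scons (e 1) (scons (e 2) e0))) c
                  (mix e (mix e0 c))).
    + apply H.
    + intros [|[|[|k]]]; cbn [scons f].
      * apply (mix_even e (mix e0 c) 0).
      * apply (mix_even e (mix e0 c) 1).
      * apply (mix_even e (mix e0 c) 2).
      * now rewrite mix_odd, mix_even.
    + intros k. now rewrite mix_odd, mix_odd.
  - intros e. apply (HR (scons (e 0) (scons (e 1) e0))).
Qed.

Lemma Dfun_close (f : M -> env -> M) (e0 : env) :
  Dfun (fun e => f (e 0) (fun n => e (S n))) -> Dfun (fun e => f (e 0) e0).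
Proof. apply (Sigma1_close2 (fun y x e => y = f x e)). Qed.

(** The witness is hidden behind an opaque proof, so that conversion never looks
    inside the operations chosen with it. *)
Lemma the_sig (P : M -> Prop) : {x | (exists x, P x) -> P x}.
Proof.
  apply constructive_indefinite_description.
  destruct (classic (exists x, P x)) as [[x H]|N]; [exists x; auto | exists m0; tauto].
Qed.
Definition the P := proj1_sig (the_sig P).
Lemma the_spec P : (exists x, P x) -> P (the P).
Proof. apply (proj2_sig (the_sig P)). Qed.

Definition upair a b := the (fun c => forall x, x ∈ c <-> x = a \/ x = b).
Definition union a := the (fun b => forall x, x ∈ b <-> exists y, y ∈ a /\ x ∈ y).
Definition pow a := the (fun b => forall x, x ∈ b <-> x ⊑ a).
Definition sepf a (Q : M -> Prop) := the (fun b => forall x, x ∈ b <-> x ∈ a /\ Q x).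
Definition repl a (F : M -> M) :=
  the (fun b => forall y, y ∈ b <-> exists x, x ∈ a /\ y = F x).

Lemma in_upair a b x : x ∈ upair a b <-> x = a \/ x = b.
Proof. apply (the_spec _ (pair_ex a b)). Qed.
Lemma in_union a x : x ∈ union a <-> exists y, y ∈ a /\ x ∈ y.
Proof. apply (the_spec _ (union_ex a)). Qed.
Lemma in_pow a x : x ∈ pow a <-> x ⊑ a.
Proof. apply (the_spec _ (pow_ex a)). Qed.
Lemma in_sepf_Sigma1 a Q x : Sigma1 (fun e => Q (e 0)) -> (x ∈ sepf a Q <-> x ∈ a /\ Q x).
Proof. intros H. apply (the_spec _ (separation_Sigma1 Q a H)). Qed.
Lemma in_sepf a Q x : Delta1 (fun e => Q (e 0)) -> (x ∈ sepf a Q <-> x ∈ a /\ Q x).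
Proof. intros [H _]. now apply in_sepf_Sigma1. Qed.

Lemma Dfun_upair f g : Dfun f -> Dfun g -> Dfun (fun e => upair (f e) (g e)).
Proof.
  apply (Dfun_app2 upair).
  apply (Sigma1_ext (fun e => (e 1 ∈ e 0 /\ e 2 ∈ e 0) /\
    forall x, x ∈ e 0 -> x = e 1 \/ x = e 2)).
  - definable.
  - intros e. split.
    + intros [[H1 H2] H3]. apply set_ext. intros z. rewrite in_upair.
      split; [apply H3 | intros [-> | ->]; auto].
    + intros ->. rewrite !in_upair. repeat split; auto. intros x. now rewrite in_upair.
Qed.

Lemma Dfun_union f : Dfun f -> Dfun (fun e => union (f e)).
Proof.
  apply (Dfun_app1 union).
  apply (Sigma1_ext (fun e => (forall x, x ∈ e 0 -> exists y, y ∈ e 1 /\ x ∈ y) /\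
    forall y, y ∈ e 1 -> forall x, x ∈ y -> x ∈ e 0)).
  - definable.
  - intros e. split.
    + intros [H1 H2]. apply set_ext. intros z. rewrite in_union. split; auto.
      intros (y & Hy & Hz). eauto.
    + intros ->. split.
      * intros x. now rewrite in_union.
      * intros y Hy x Hx. apply in_union. eauto.
Qed.

(** Here, and only here, the quantifiers bounded by inclusion are used: every
    later one ranges over the elements of a power set. *)
Lemma Dfun_pow f : Dfun f -> Dfun (fun e => pow (f e)).
Proof.
  apply (Dfun_app1 pow). apply Delta0_Sigma1.
  apply (Delta0_ext (fun e => (forall x, x ∈ e 0 -> forall z, z ∈ x -> z ∈ e 1) /\
    forall x, x ⊑ e 1 -> x ∈ e 0)).
  - apply Delta0_and.
    + apply (Delta0_allin 0 (fun e => forall z, z ∈ e 0 -> z ∈ e 2)).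
      apply (Delta0_allin 0 (fun e => e 0 ∈ e 3)). apply Delta0_mem.
    + apply (Delta0_allsub 1 (fun e => e 0 ∈ e 1)). apply Delta0_mem.
  - intros e. split.
    + intros [H1 H2]. apply set_ext. intros z. rewrite in_pow. firstorder.
    + intros ->. split; intros x; now rewrite in_pow.
Qed.

Lemma Dfun_sepf g Q : Dfun g -> Delta1 (fun e => Q (e 0) (fun n => e (S n))) ->
  Dfun (fun e => sepf (g e) (fun x => Q x e)).
Proof.
  intros Hg HQ. unfold Dfun.
  apply (Sigma1_ext (fun e => (forall x, x ∈ e 0 -> x ∈ g (fun n => e (S n)) /\
      Q x (fun n => e (S n))) /\
    forall x, x ∈ g (fun n => e (S n)) -> Q x (fun n => e (S n)) -> x ∈ e 0)).
  - assert (K : Delta1 (fun e => Q (e 0) (fun n => e (S (S n))))).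
    { destruct HQ as [H1 H2].
      split; [exact (Sigma1_ren (fun n => match n with 0 => 0 | S n => S (S n) end) _ H1)
             |exact (Sigma1_ren (fun n => match n with 0 => 0 | S n => S (S n) end) _ H2)]. }
    pose proof (Dfun_tail _ Hg). pose proof (Dfun_tail _ (Dfun_tail _ Hg)).
    apply Delta1_Sigma1, Delta1_and; (apply Delta1_all; [definable|]).
    + apply Delta1_and; [definable | exact K].
    + apply Delta1_imp; [exact K | definable].
  - intros e. split.
    + intros [H1 H2]. apply set_ext. intros z.
      rewrite in_sepf by exact (Delta1_close Q _ HQ). firstorder.
    + intros ->. split; intros x; rewrite in_sepf by exact (Delta1_close Q _ HQ); auto.
Qed.

Lemma in_repl a F y : Dfun (fun e => F (e 0)) ->
  (y ∈ repl a F <-> exists x, x ∈ a /\ y = F x).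
Proof.
  intros HF. apply (the_spec (fun b => forall y, y ∈ b <-> exists x, x ∈ a /\ y = F x)).
  assert (K : Dfun (fun e => F (e 1))).
  { exact (Sigma1_ren (fun n => match n with 0 => 0 | S n => S (S n) end) _ HF). }
  destruct (collection_Sigma1 (fun x y => y = F x) a) as [b Hb].
  - apply (Sigma1_ren (fun n => match n with 0 => 1 | 1 => 0 | n => n end) _ HF).
  - intros x _. exists (F x). reflexivity.
  - destruct (separation_Sigma1 (fun y => exists x, x ∈ a /\ y = F x) b) as [c Hc].
    + apply Delta1_Sigma1. apply Delta1_exb; [definable|]. apply Delta1_eq; auto; definable.
    + exists c. intros z. rewrite Hc. split; [tauto|].
      intros (x & Hx & ->). split; [|eauto]. destruct (Hb x Hx) as (w & Hw & ->). auto.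
Qed.

Lemma Dfun_repl g F : Dfun g -> Dfun (fun e => F (e 0) (fun n => e (S n))) ->
  Dfun (fun e => repl (g e) (fun x => F x e)).
Proof.
  intros Hg HF. unfold Dfun.
  apply (Sigma1_ext (fun e => (forall y, y ∈ e 0 -> exists x, x ∈ g (fun n => e (S n)) /\
      y = F x (fun n => e (S n))) /\
    forall x, x ∈ g (fun n => e (S n)) -> F x (fun n => e (S n)) ∈ e 0)).
  - pose proof (Dfun_tail _ Hg) as G1. pose proof (Dfun_tail _ G1) as G2.
    assert (K1 : Dfun (fun e => F (e 0) (fun n => e (S (S n))))).
    { exact (Sigma1_ren (fun n => match n with 0 => 0 | 1 => 1 | S n => S (S n) end) _ HF). }
    assert (K2 : Dfun (fun e => F (e 0) (fun n => e (S (S (S n)))))).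
    { exact (Sigma1_ren (fun n => match n with 0 => 0 | 1 => 1 | S n => S (S (S n)) end) _ HF).
        }
    apply Delta1_Sigma1, Delta1_and; (apply Delta1_all; [definable|]).
    + apply Delta1_exb; [exact G2|]. apply Delta1_eq; [definable | exact K2].
    + apply Delta1_mem; [exact K1 | definable].
  - intros e. split.
    + intros [H1 H2]. apply set_ext. intros z.
      rewrite in_repl by exact (Dfun_close F _ HF). split; auto.
      intros (x & Hx & ->). auto.
    + intros ->. split; intros x; rewrite in_repl by exact (Dfun_close F _ HF); eauto.
Qed.

Hint Resolve Dfun_upair Dfun_union Dfun_pow Dfun_sepf Dfun_repl : definable.

Opaque upair union pow sepf repl.

Lemma image_Sigma1 (Q : M -> M -> Prop) a : Sigma1 (fun e => Q (e 0) (e 1)) ->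
  (forall x, x ∈ a -> exists y, Q x y) ->
  (forall x y z, x ∈ a -> Q x y -> Q x z -> y = z) ->
  exists b, forall y, y ∈ b <-> exists x, x ∈ a /\ Q x y.
Proof.
  intros HQ Hex Hun.
  destruct (collection_Sigma1 Q a HQ Hex) as [b Hb].
  destruct (separation_Sigma1 (fun y => exists x, x ∈ a /\ Q x y) b) as [c Hc].
  - apply Sigma1_exb; [definable | exact HQ].
  - exists c. intros y. rewrite Hc. split; [tauto|].
    intros (x & Hx & K). split; [|eauto].
    destruct (Hb x Hx) as (z & Hz & L). now rewrite (Hun x y z).
Qed.

Definition sing a := upair a a.
Definition emp := sepf m0 (fun _ => False).
Definition cup a b := union (upair a b).
Definition suc a := cup a (sing a).
Definition opair a b := upair (sing a) (upair a b).
Definition prod a b := union (repl a (fun x => repl b (fun y => opair x y))).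
(** The first component of an ordered pair, as the union of its intersection. *)
Definition fst p := union (sepf (union p) (fun x => forall q, q ∈ p -> x ∈ q)).
(** For a functional [f] this is its value at [x], the union of a singleton. *)
Definition lk f x := union (sepf (union (union f)) (fun v => opair x v ∈ f)).

Lemma Dfun_sing f : Dfun f -> Dfun (fun e => sing (f e)).
Proof. intros. unfold sing. definable. Qed.
Hint Resolve Dfun_sing : definable.
Lemma Dfun_cup f g : Dfun f -> Dfun g -> Dfun (fun e => cup (f e) (g e)).
Proof. intros. unfold cup. definable. Qed.
Hint Resolve Dfun_cup : definable.
Lemma Dfun_suc f : Dfun f -> Dfun (fun e => suc (f e)).
Proof. intros. unfold suc. definable. Qed.
Lemma Dfun_opair f g : Dfun f -> Dfun g -> Dfun (fun e => opair (f e) (g e)).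
Proof. intros. unfold opair. definable. Qed.
Hint Resolve Dfun_suc Dfun_opair : definable.
Lemma Dfun_prod f g : Dfun f -> Dfun g -> Dfun (fun e => prod (f e) (g e)).
Proof. apply (Dfun_app2 prod). unfold prod. change (Dfun (fun e => prod (e 0) (e 1))).
    unfold prod. definable. Qed.
Lemma Dfun_fst f : Dfun f -> Dfun (fun e => fst (f e)).
Proof. apply (Dfun_app1 fst). change (Dfun (fun e => fst (e 0))). unfold fst. definable. Qed.
Lemma Dfun_lk f g : Dfun f -> Dfun g -> Dfun (fun e => lk (f e) (g e)).
Proof. apply (Dfun_app2 lk). change (Dfun (fun e => lk (e 0) (e 1))). unfold lk. definable. Qed.
Hint Resolve Dfun_prod Dfun_fst Dfun_lk : definable.

Lemma in_sing a x : x ∈ sing a <-> x = a.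
Proof. unfold sing. rewrite in_upair. tauto. Qed.
Lemma in_emp x : ~ x ∈ emp.
Proof.
  unfold emp. rewrite in_sepf; [tauto|].
  apply Delta0_Delta1, Delta0_bot.
Qed.
Lemma in_cup a b x : x ∈ cup a b <-> x ∈ a \/ x ∈ b.
Proof.
  unfold cup. rewrite in_union. split.
  - intros (y & Hy & Hx). apply in_upair in Hy. destruct Hy as [-> | ->]; auto.
  - intros [H|H]; [exists a | exists b]; rewrite in_upair; auto.
Qed.
Lemma in_suc a x : x ∈ suc a <-> x ∈ a \/ x = a.
Proof. unfold suc. now rewrite in_cup, in_sing. Qed.

Lemma sing_inj a b : sing a = sing b -> a = b.
Proof. intros H. apply in_sing. rewrite <- H. now apply in_sing. Qed.

Lemma upair_inj_r a b c : upair a b = upair a c -> b = c.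
Proof.
  intros H. assert (Hb : b ∈ upair a c) by (rewrite <- H; apply in_upair; auto).
  assert (Hc : c ∈ upair a b) by (rewrite H; apply in_upair; auto).
  apply in_upair in Hb, Hc. destruct Hb, Hc; congruence.
Qed.

Lemma opair_inj a b c d : opair a b = opair c d -> a = c /\ b = d.
Proof.
  intros H.
  assert (a = c).
  { assert (K : sing c ∈ opair a b) by (rewrite H; apply in_upair; auto).
    apply in_upair in K. destruct K as [K|K]; [symmetry; now apply sing_inj|].
    apply in_sing. rewrite K. apply in_upair. auto. }
  subst c. split; auto.
  unfold opair in H. apply upair_inj_r, upair_inj_r in H. exact H.
Qed.

Lemma fst_opair a b : fst (opair a b) = a.
Proof.
  apply set_ext. intros z. unfold fst. rewrite in_union. split.
  - intros (y & Hy & Hz). apply in_sepf in Hy; [|definable]. destruct Hy as [_ Hy].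
    assert (K : y ∈ sing a) by (apply Hy; apply in_upair; auto).
    apply in_sing in K. now subst y.
  - intros Hz. exists a. split; auto. apply in_sepf; [definable|]. split.
    + apply in_union. exists (sing a). split; [apply in_upair; auto | now apply in_sing].
    + intros q Hq. apply in_upair in Hq.
      destruct Hq as [-> | ->]; [apply in_sing | apply in_upair]; auto.
Qed.

Lemma in_lk f x z : z ∈ lk f x <-> exists v, opair x v ∈ f /\ z ∈ v.
Proof.
  unfold lk. rewrite in_union. split.
  - intros (v & Hv & Hz). apply in_sepf in Hv; [|definable]. destruct Hv. eauto.
  - intros (v & Hv & Hz). exists v. split; auto. apply in_sepf; [definable|]. split; auto.
    apply in_union. exists (upair x v). split; [|apply in_upair; auto].
    apply in_union. exists (opair x v). split; auto. apply in_upair. auto.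
Qed.

Lemma lk_repl a F x : Dfun (fun e => F (e 0)) -> x ∈ a ->
  lk (repl a (fun y => opair y (F y))) x = F x.
Proof.
  intros HF Hx. apply set_ext. intros z. rewrite in_lk.
  split.
  - intros (v & Hv & Hz). apply in_repl in Hv; [|definable].
    destruct Hv as (y & _ & E). apply opair_inj in E. destruct E as [-> ->]. exact Hz.
  - intros Hz. exists (F x). split; auto. apply in_repl; [definable|]. eauto.
Qed.

Lemma in_prod a b p : p ∈ prod a b <-> exists x y, x ∈ a /\ y ∈ b /\ p = opair x y.
Proof.
  unfold prod. rewrite in_union. split.
  - intros (y & Hy & Hp). apply in_repl in Hy; [|definable].
    destruct Hy as (x & Hx & ->). apply in_repl in Hp; [|definable].
    destruct Hp as (y & Hy & ->). eauto 6.
  - intros (x & y & Hx & Hy & ->). exists (repl b (fun y => opair x y)). split.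
    + apply in_repl; [definable|]. eauto.
    + apply in_repl; [definable|]. eauto.
Qed.

Lemma opair_in_prod a b x y : opair x y ∈ prod a b <-> x ∈ a /\ y ∈ b.
Proof.
  rewrite in_prod. split.
  - intros (x' & y' & Hx & Hy & E). apply opair_inj in E. destruct E as [-> ->]. auto.
  - intros [Hx Hy]. eauto 6.
Qed.

(** ** Transitive closure *)

Definition trans d := forall x, x ∈ d -> forall y, y ∈ x -> y ∈ d.

Lemma Delta1_trans f : Dfun f -> Delta1 (fun e => trans (f e)).
Proof. apply (Delta1_app1 trans). unfold trans. definable. Qed.
Hint Resolve Delta1_trans : definable.

(** If every element of [x] has a transitive superset, then the union of those
    gathered by Collection, with [x] thrown in, is one for [x]. *)
Lemma trans_superset x : exists d, trans d /\ x ⊑ d.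
Proof.
  apply (ind_Sigma1 (fun x => exists d, trans d /\ forall z, z ∈ x -> z ∈ d)); [definable|].
  clear x. intros x IH.
  destruct (collection_Sigma1 (fun y d => trans d /\ forall z, z ∈ y -> z ∈ d) x)
    as [b Hb]; [definable | exact IH |].
  exists (cup x (union (sepf b trans))). split.
  - intros y Hy z Hz. apply in_cup. right. apply in_cup in Hy. apply in_union.
    destruct Hy as [Hy|Hy].
    + destruct (Hb y Hy) as (d & Hd & Td & K). exists d. split; auto.
      apply in_sepf; [definable|]. auto.
    + apply in_union in Hy. destruct Hy as (d & Hd & Hy). exists d. split; auto.
      apply in_sepf in Hd; [|definable]. destruct Hd as [_ Td]. apply (Td y); auto.
  - intros z Hz. apply in_cup. auto.
Qed.

(** Minimality is stated against the subsets of [t] only, which keeps it bounded. *)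
Definition is_TC x t := trans t /\ (forall z, z ∈ x -> z ∈ t) /\
  forall d, d ∈ pow t -> trans d -> (forall z, z ∈ x -> z ∈ d) -> d = t.
Definition TC x := the (is_TC x).

Lemma TC_spec x : is_TC x (TC x).
Proof.
  apply (the_spec (is_TC x)). destruct (trans_superset x) as (d & Td & Hd).
  pose (t := sepf d (fun y => forall c, c ∈ pow d -> trans c ->
    (forall z, z ∈ x -> z ∈ c) -> y ∈ c)).
  assert (Ht : forall y, y ∈ t <-> y ∈ d /\ forall c, c ∈ pow d -> trans c ->
    (forall z, z ∈ x -> z ∈ c) -> y ∈ c) by (intros y; apply in_sepf; definable).
  exists t. split; [|split].
  - intros y Hy z Hz. apply Ht in Hy. destruct Hy as [Hy K]. apply Ht. split.
    + exact (Td y Hy z Hz).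
    + intros c Hc Tc Hx. apply (Tc y); auto.
  - intros z Hz. apply Ht. split; auto.
  - intros c Hc Tc Hx. rewrite in_pow in Hc. apply set_ext. intros z.
    split; auto. intros Hz. apply Ht in Hz. destruct Hz as [_ Hz].
    apply Hz; auto. apply in_pow. intros w Hw. exact (proj1 (proj1 (Ht w) (Hc w Hw))).
Qed.

Lemma TC_trans x : trans (TC x).
Proof. apply TC_spec. Qed.
Lemma TC_sub x y : y ∈ x -> y ∈ TC x.
Proof. apply TC_spec. Qed.
Lemma TC_least x d : trans d -> x ⊑ d -> TC x ⊑ d.
Proof.
  intros Td Hd. destruct (TC_spec x) as (Tt & Ht & K).
  rewrite <- (K (sepf (TC x) (fun y => y ∈ d))).
  - intros z Hz. apply in_sepf in Hz; [tauto|definable].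
  - apply in_pow. intros z Hz. apply in_sepf in Hz; [tauto|definable].
  - intros y Hy z Hz. apply in_sepf in Hy; [|definable]. apply in_sepf; [definable|].
    destruct Hy as [Hy1 Hy2]. split; [apply (Tt y); auto | apply (Td y); auto].
  - intros z Hz. apply in_sepf; [definable|]. auto.
Qed.

Lemma is_TC_unique x t : is_TC x t -> t = TC x.
Proof.
  intros (Tt & Ht & K). apply set_ext. intros z. split.
  - intros Hz. rewrite <- (K (TC x)) in Hz; auto.
    + apply in_pow. now apply TC_least.
    + apply TC_trans.
    + apply TC_sub.
  - now apply TC_least.
Qed.

Lemma Dfun_TC f : Dfun f -> Dfun (fun e => TC (f e)).
Proof.
  apply (Dfun_app1 TC). apply (Sigma1_ext (fun e => is_TC (e 1) (e 0))).
  - unfold is_TC. definable.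
  - intros e. split; [apply is_TC_unique | intros ->; apply TC_spec].
Qed.
Hint Resolve Dfun_TC : definable.

Opaque TC.

Lemma TC_step x y : y ∈ x -> TC y ⊑ TC x.
Proof.
  intros H. apply TC_least; [apply TC_trans|]. intros z Hz.
  apply (TC_trans x y); auto. now apply TC_sub.
Qed.

Lemma TC_mono x y : y ∈ TC x -> TC y ⊑ TC x.
Proof.
  intros H. apply TC_least; [apply TC_trans|]. intros z Hz.
  now apply (TC_trans x y).
Qed.

(** Induction for universal predicates: the counterexamples below a given one
    form a set by Separation. *)
Lemma ind_Pi1 (P : M -> Prop) : Sigma1 (fun e => ~ P (e 0)) ->
  (forall x, (forall y, y ∈ x -> P y) -> P x) -> forall x, P x.
Proof.
  intros HP IH x. apply NNPP. intros Hx.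
  destruct (separation_Sigma1 (fun y => ~ P y) (TC (sing x)) HP) as [b Hb].
  assert (K : forall y, ~ y ∈ b).
  { apply ind_Sigma1; [definable|]. intros y Hy Hyb. apply Hb in Hyb. destruct Hyb as [Hy1 Hy2].
    apply Hy2, IH. intros z Hz. apply NNPP. intros N. apply (Hy z Hz).
    apply Hb. split; auto. exact (TC_trans _ y Hy1 z Hz). }
  apply (K x). apply Hb. split; auto. apply TC_sub, in_sing. reflexivity.
Qed.

Lemma in_TC x y : y ∈ TC x <-> exists z, z ∈ x /\ (y = z \/ y ∈ TC z).
Proof.
  split.
  - assert (K : trans (cup x (union (repl x TC)))).
    { intros a Ha b Hb. apply in_cup. right. apply in_union. apply in_cup in Ha.
      destruct Ha as [Ha|Ha].
      - exists (TC a). split; [apply in_repl; [definable|]; eauto | now apply TC_sub].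
      - apply in_union in Ha. destruct Ha as (d & Hd & Ha). exists d. split; auto.
        apply in_repl in Hd; [|definable]. destruct Hd as (w & _ & ->).
        now apply (TC_trans w a). }
    intros H.
    assert (K' : x ⊑ cup x (union (repl x TC))) by (intros z Hz; apply in_cup; auto).
    apply (TC_least x _ K K') in H.
    apply in_cup in H. destruct H as [H|H]; [eauto|].
    apply in_union in H. destruct H as (d & Hd & H).
    apply in_repl in Hd; [|definable]. destruct Hd as (w & Hw & ->). eauto.
  - intros (z & Hz & [-> | H]); [now apply TC_sub | now apply (TC_step x z Hz)].
Qed.

Lemma ind_TC_Pi1 (P : M -> Prop) : Sigma1 (fun e => ~ P (e 0)) ->
  (forall x, (forall y, y ∈ TC x -> P y) -> P x) -> forall x, P x.
Proof.
  intros HP IH.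
  assert (K : forall x, forall y, y ∈ TC x -> P y).
  { apply (ind_Pi1 (fun x => forall y, y ∈ TC x -> P y)).
    - apply (Sigma1_ext (fun e => exists y, y ∈ TC (e 0) /\ ~ P y)).
      + apply (Sigma1_exb (fun e => TC (e 0)) (fun y _ => ~ P y)); [definable | exact HP].
      + intros e. split; [firstorder|]. intros N. apply NNPP. intros N'. apply N.
        intros y Hy. apply NNPP. intros L. apply N'. exists y. auto.
    - intros x H y Hy. apply in_TC in Hy. destruct Hy as (z & Hz & [-> | Hy]).
      + apply IH. now apply H.
      + now apply (H z). }
  intros x. apply IH, K.
Qed.

Lemma ind_TC_Sigma1 (P : M -> Prop) : Sigma1 (fun e => P (e 0)) ->
  (forall x, (forall y, y ∈ TC x -> P y) -> P x) -> forall x, P x.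
Proof.
  intros HP IH.
  assert (K : forall x, forall y, y ∈ TC x -> P y).
  { apply (ind_Sigma1 (fun x => forall y, y ∈ TC x -> P y)).
    - apply (Sigma1_all (fun e => TC (e 0)) (fun y _ => P y)); [definable | exact HP].
    - intros x H y Hy. apply in_TC in Hy. destruct Hy as (z & Hz & [-> | Hy]).
      + apply IH. now apply H.
      + now apply (H z). }
  intros x. apply IH, K.
Qed.

Lemma in_irrefl x : ~ x ∈ x.
Proof.
  apply (ind_Sigma1 (fun x => ~ x ∈ x)); [definable|]. intros y H K. exact (H y K K).
Qed.

(** ** Definition by recursion along the transitive closure *)

Section Recursion.
Variable G : M -> M -> M -> M.
Hypothesis HG : Dfun (fun e => G (e 0) (e 1) (e 2)).
Variable A : M.

Lemma Dfun_G f g h : Dfun f -> Dfun g -> Dfun h -> Dfun (fun e => G (f e) (g e) (h e)).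
Proof. apply Dfun_app3. exact HG. Qed.
Hint Resolve Dfun_G : definable.

Definition rst f x := sepf f (fun p => fst p ∈ TC x).
Lemma Dfun_rst f g : Dfun f -> Dfun g -> Dfun (fun e => rst (f e) (g e)).
Proof. apply (Dfun_app2 rst). change (Dfun (fun e => rst (e 0) (e 1))). unfold rst. definable.
    Qed.
Hint Resolve Dfun_rst : definable.
Lemma in_rst f x p : p ∈ rst f x <-> p ∈ f /\ fst p ∈ TC x.
Proof. apply (in_sepf f (fun p => fst p ∈ TC x)). definable. Qed.

(** A set function on [d] obeying the recursion; the single equation also says
    that it is a function with domain [d]. *)
Definition attempt f d A := f = repl d (fun x => opair x (G A x (rst f x))).

Lemma Delta1_attempt f d A' : Dfun f -> Dfun d -> Dfun A' ->
    Delta1 (fun e => attempt (f e) (d e) (A' e)).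
Proof.
  intros. apply (Delta1_subst3 attempt); auto.
  change (Delta1 (fun e => attempt (e 0) (e 1) (e 2))). unfold attempt. definable.
Qed.
Hint Resolve Delta1_attempt : definable.

Lemma in_attempt f d p : attempt f d A ->
  (p ∈ f <-> exists x, x ∈ d /\ p = opair x (G A x (rst f x))).
Proof.
  unfold attempt. intros H.
  rewrite <- (in_repl d (fun x => opair x (G A x (rst f x))) p) by definable.
  now rewrite <- H.
Qed.

(** By induction along the transitive closure: the recursion equation makes the
    entries at [y] depend only on those below [y]. *)
Lemma attempt_agree f f' d d' : attempt f d A -> attempt f' d' A -> trans d -> trans d' ->
  forall x, x ∈ d -> x ∈ d' -> rst f x = rst f' x.
Proof.
  intros Hf Hf' Td Td'.
  assert (S : forall f f' d d', attempt f d A -> attempt f' d' A -> trans d -> trans d' ->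
    forall x, x ∈ d -> x ∈ d' -> (forall y, y ∈ TC x -> y ∈ d -> y ∈ d' ->
        rst f y = rst f' y) ->
    forall p, p ∈ rst f x -> p ∈ rst f' x).
  { clear f f' d d' Hf Hf' Td Td'. intros f f' d d' Hf Hf' Td Td' x Hx Hx' IH p Hp.
    apply in_rst in Hp. destruct Hp as [Hp Hpx]. apply in_rst. split; auto.
    apply (in_attempt _ _ _ Hf) in Hp. destruct Hp as (y & Hy & ->).
    rewrite fst_opair in Hpx.
    assert (Hy' : y ∈ d').
    { apply (TC_least x d' Td'); auto. intros z. apply (Td' x Hx'). }
    apply (in_attempt _ _ _ Hf'). exists y. split; auto. rewrite IH; auto. }
  apply (ind_TC_Pi1 (fun x => x ∈ d -> x ∈ d' -> rst f x = rst f' x)); [definable|].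
  intros x IH Hx Hx'. apply set_ext. intros p. split.
  - apply (S f f' d d'); auto.
  - apply (S f' f d' d); auto. intros y Hy H1 H2. symmetry. auto.
Qed.

Lemma attempt_unique f f' d : attempt f d A -> attempt f' d A -> trans d -> f = f'.
Proof.
  intros Hf Hf' Td. apply set_ext. intros p.
  rewrite (in_attempt _ _ _ Hf), (in_attempt _ _ _ Hf').
  split; intros (x & Hx & ->); exists x; split; auto; f_equal; f_equal;
    [| symmetry]; apply (attempt_agree f f' d d); auto.
Qed.

Lemma rst_rst f x y : y ∈ TC x -> rst (rst f x) y = rst f y.
Proof.
  intros H. apply set_ext. intros p. rewrite !in_rst. split; [tauto|].
  intros [H1 H2]. repeat split; auto. exact (TC_mono x y H _ H2).
Qed.

Lemma attempt_rst f d x : attempt f d A -> trans d -> x ∈ d -> attempt (rst f x) (TC x) A.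
Proof.
  intros Hf Td Hx. unfold attempt. apply set_ext. intros p. rewrite in_rst.
  rewrite in_repl by definable. rewrite (in_attempt _ _ _ Hf). split.
  - intros [(y & Hy & ->) Hp]. rewrite fst_opair in Hp. exists y. split; auto.
    now rewrite rst_rst.
  - intros (y & Hy & ->). rewrite fst_opair, rst_rst by auto. split; auto.
    exists y. split; auto. apply (TC_least x d Td); auto. intros z. apply (Td x Hx).
Qed.

(** The attempts below [x] are unique, so their values at the elements of the
    transitive closure of [x] form a set, which is an attempt for [x]. *)
Lemma attempt_trans_ex x : exists f, attempt f (TC x) A.
Proof.
  apply (ind_TC_Sigma1 (fun x => exists f, attempt f (TC x) A)); [definable|].
  clear x. intros x IH.
  destruct (image_Sigma1 (fun y p => exists f, attempt f (TC y) A /\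
      p = opair y (G A y f)) (TC x))
    as [g Hg].
  - definable.
  - intros y Hy. destruct (IH y Hy) as [f Hf]. eauto.
  - intros y p q _ (f & Hf & ->) (f' & Hf' & ->).
    now rewrite (attempt_unique f f' (TC y)) by auto using TC_trans.
  - exists g.
    assert (R : forall y f, y ∈ TC x -> attempt f (TC y) A -> rst g y = f).
    { intros y f Hy Hf. apply set_ext. intros p.
      rewrite in_rst, (in_attempt _ _ _ Hf), Hg. split.
      - intros [(z & Hz & h & Hh & ->) Hp]. rewrite fst_opair in Hp. exists z. split; auto.
        rewrite (attempt_unique h (rst f z) (TC z)); auto using TC_trans.
        apply (attempt_rst f (TC y)); auto using TC_trans.
      - intros (z & Hz & ->). rewrite fst_opair. split; auto.
        exists z. split; [exact (TC_mono x y Hy z Hz)|]. exists (rst f z).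
        split; auto. apply (attempt_rst f (TC y)); auto using TC_trans. }
    apply set_ext. intros p. rewrite Hg, in_repl by definable. split.
    + intros (y & Hy & f & Hf & ->). exists y. split; auto. now rewrite (R y f).
    + intros (y & Hy & ->). exists y. split; auto. destruct (IH y Hy) as [f Hf].
      exists f. split; auto. now rewrite (R y f).
Qed.

Definition rec x := G A x (the (fun f => attempt f (TC x) A)).

Lemma rec_attempt x f : attempt f (TC x) A -> rec x = G A x f.
Proof.
  intros Hf. unfold rec. f_equal.
  apply (attempt_unique _ _ (TC x)); auto using TC_trans.
  apply (the_spec (fun f => attempt f (TC x) A)). eauto.
Qed.
End Recursion.

(** The recursion theorem; earlier values are presented as a set function. *)
Theorem recursion (G : M -> M -> M -> M) : Dfun (fun e => G (e 0) (e 1) (e 2)) ->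
  {F : M -> M -> M | Dfun (fun e => F (e 0) (e 1)) /\
    forall A x, exists f, F A x = G A x f /\ forall y, y ∈ TC x -> lk f y = F A y}.
Proof.
  intros HG. exists (rec G). split.
  - apply (Sigma1_ext (fun e => exists h, attempt G h (TC (e 2)) (e 1) /\
      e 0 = G (e 1) (e 2) h)).
    + apply Sigma1_ex', Delta1_Sigma1, Delta1_and.
      * apply Delta1_attempt; definable || auto.
      * apply Delta1_eq; [definable|]. apply Dfun_app3; auto; definable.
    + intros e. split.
      * intros (h & Hh & ->). symmetry. now apply rec_attempt.
      * intros ->. destruct (attempt_trans_ex G HG (e 1) (e 2)) as [h Hh].
        exists h. split; auto. now apply rec_attempt.
  - intros A x. destruct (attempt_trans_ex G HG A x) as [f Hf].
    exists f. split; [now apply rec_attempt|].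
    intros y Hy.
    transitivity (lk (repl (TC x) (fun y => opair y (G A y (rst f y)))) y);
      [now rewrite <- Hf|].
    rewrite (lk_repl _ (fun y => G A y (rst f y))); auto.
    + symmetry. apply rec_attempt; auto.
      apply (attempt_rst G HG A f (TC x)); auto using TC_trans.
    + apply Dfun_app3; auto using Dfun_rst, Dfun_const, Dfun_var.
Qed.

(** ** The cumulative hierarchy and ranks *)

(** The hierarchy is indexed by arbitrary sets: [V x] consists of the sets of
    rank below the rank of [x], so that ranks are compared without ordinals. *)
Lemma V_sig : {V : M -> M | Dfun (fun e => V (e 0)) /\
  forall x z, z ∈ V x <-> exists y, y ∈ x /\ z ⊑ V y}.
Proof.
  destruct (recursion (fun _ x f => union (repl x (fun y => pow (lk f y)))))
    as (F & HF & E); [definable|].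
  exists (F emp). split; [exact (Dfun_app2 F _ _ HF (Dfun_const emp) (Dfun_var 0))|].
  intros x z. destruct (E emp x) as (f & -> & Hf). rewrite in_union. split.
  - intros (p & Hp & Hz). apply in_repl in Hp; [|definable]. destruct Hp as (y & Hy & ->).
    exists y. split; auto. rewrite in_pow, Hf in Hz by now apply TC_sub. exact Hz.
  - intros (y & Hy & Hz). exists (pow (lk f y)). split.
    + apply in_repl; [definable|]. eauto.
    + rewrite in_pow, Hf by now apply TC_sub. exact Hz.
Qed.
Definition V := proj1_sig V_sig.
Lemma in_V x z : z ∈ V x <-> exists y, y ∈ x /\ z ⊑ V y.
Proof. apply (proj2 (proj2_sig V_sig)). Qed.
Lemma Dfun_V f : Dfun f -> Dfun (fun e => V (f e)).
Proof. apply (Dfun_app1 V), (proj1 (proj2_sig V_sig)). Qed.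

Lemma rk_sig : {rk : M -> M | Dfun (fun e => rk (e 0)) /\
  forall x z, z ∈ rk x <-> exists y, y ∈ x /\ (z ∈ rk y \/ z = rk y)}.
Proof.
  destruct (recursion (fun _ x f => union (repl x (fun y => suc (lk f y)))))
    as (F & HF & E); [definable|].
  exists (F emp). split; [exact (Dfun_app2 F _ _ HF (Dfun_const emp) (Dfun_var 0))|].
  intros x z. destruct (E emp x) as (f & -> & Hf). rewrite in_union. split.
  - intros (p & Hp & Hz). apply in_repl in Hp; [|definable]. destruct Hp as (y & Hy & ->).
    exists y. split; auto. rewrite in_suc, Hf in Hz by now apply TC_sub. exact Hz.
  - intros (y & Hy & Hz). exists (suc (lk f y)). split.
    + apply in_repl; [definable|]. eauto.
    + rewrite in_suc, Hf by now apply TC_sub. exact Hz.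
Qed.
Definition rk := proj1_sig rk_sig.
Lemma in_rk x z : z ∈ rk x <-> exists y, y ∈ x /\ (z ∈ rk y \/ z = rk y).
Proof. apply (proj2 (proj2_sig rk_sig)). Qed.
Lemma Dfun_rk f : Dfun f -> Dfun (fun e => rk (f e)).
Proof. apply (Dfun_app1 rk), (proj1 (proj2_sig rk_sig)). Qed.
Hint Resolve Dfun_V Dfun_rk : definable.

Lemma V_sub_closed x y z : y ∈ V x -> z ⊑ y -> z ∈ V x.
Proof.
  intros H K. apply in_V in H. destruct H as (w & Hw & H). apply in_V.
  exists w. split; auto.
Qed.

Lemma V_trans x : trans (V x).
Proof.
  apply (ind_Sigma1 (fun x => trans (V x))); [definable|]. clear x. intros x IH y Hy z Hz.
  apply in_V in Hy. destruct Hy as (w & Hw & Hy). apply in_V.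
  exists w. split; auto. exact (IH w Hw z (Hy z Hz)).
Qed.

Lemma V_self x : x ⊑ V x.
Proof.
  apply (ind_Sigma1 (fun x => forall z, z ∈ x -> z ∈ V x)); [definable|].
  clear x. intros x IH y Hy. apply in_V. exists y. auto.
Qed.

Lemma V_in x y : y ∈ V x -> V y ∈ V x.
Proof.
  revert y. apply (ind_Sigma1 (fun x => forall y, y ∈ V x -> V y ∈ V x)); [definable|].
  clear x. intros x IH y Hy. apply in_V in Hy. destruct Hy as (w & Hw & Hy).
  apply in_V. exists w. split; auto. intros z Hz. apply in_V in Hz.
  destruct Hz as (u & Hu & Hz). apply (V_sub_closed w (V u)); auto.
Qed.

Lemma V_mono x y : y ⊑ V x -> V y ⊑ V x.
Proof.
  intros H z Hz. apply in_V in Hz. destruct Hz as (u & Hu & Hz).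
  apply (V_sub_closed x (V u)); auto. apply V_in. auto.
Qed.

Lemma V_mono_in x y : y ∈ V x -> V y ⊑ V x.
Proof. intros H. apply V_mono. intros z. exact (V_trans x y H z). Qed.

Lemma V_irrefl x : ~ x ∈ V x.
Proof. intros H. apply V_in in H. now apply in_irrefl in H. Qed.

Lemma in_V_sing x z : z ∈ V (sing x) <-> z ⊑ V x.
Proof.
  rewrite in_V. split.
  - intros (y & Hy & Hz). apply in_sing in Hy. now subst y.
  - intros H. exists x. rewrite in_sing. auto.
Qed.

(** Ranks are linearly ordered: if some element [z] of [y] is not in [V x], then
    by induction every element of [x] is in [V z]. *)
Lemma V_linear x y : x ∈ V y \/ y ⊑ V x.
Proof.
  revert y.
  apply (ind_Pi1 (fun x => forall y, x ∈ V y \/ forall z, z ∈ y -> z ∈ V x)).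
  - apply (Sigma1_ext (fun e => exists y, ~ (e 0 ∈ V y \/ forall z, z ∈ y -> z ∈ V (e 0)))).
    + definable.
    + intros e. split; [intros [y Hy] K; exact (Hy (K y))|].
      intros N. apply not_all_ex_not in N. exact N.
  - clear x. intros x IH y. destruct (classic (y ⊑ V x)) as [H|H]; auto. left.
    apply not_all_ex_not in H. destruct H as [z H].
    apply imply_to_and in H. destruct H as [Hz H].
    apply in_V. exists z. split; auto. intros w Hw.
    destruct (IH w Hw z) as [K|K]; auto.
    exfalso. apply H. apply in_V. eauto.
Qed.

(** ** Ordinals *)

Local Notation ord := (is_ord M).

(** The same notion with bounded quantifiers only. *)
Definition ordb a := trans a /\
  forall x, x ∈ a -> forall y, y ∈ a -> x ∈ y \/ x = y \/ y ∈ x.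
Lemma ordb_iff a : ordb a <-> ord a.
Proof.
  split; intros [T L]; split.
  - intros x y Hx Hy. exact (T x Hx y Hy).
  - intros x y Hx Hy. exact (L x Hx y Hy).
  - intros x Hx y Hy. exact (T x y Hx Hy).
  - intros x Hx y Hy. exact (L x y Hx Hy).
Qed.
Lemma Delta1_ordb f : Dfun f -> Delta1 (fun e => ordb (f e)).
Proof. apply (Delta1_app1 ordb). unfold ordb. definable. Qed.
Hint Resolve Delta1_ordb : definable.

Lemma set_min b x : x ∈ b -> exists y, y ∈ b /\ forall z, z ∈ y -> ~ z ∈ b.
Proof.
  intros Hx. apply NNPP. intros N.
  apply (ind_Sigma1 (fun x => ~ x ∈ b)) in Hx; auto; [definable|].
  intros y Hy Hyb. apply N. eauto.
Qed.

Lemma ord_mem a x : ord a -> x ∈ a -> ord x.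
Proof.
  intros [T L] Hx. split.
  - intros y z Hy Hz. assert (Hya : y ∈ a) by eauto. assert (Hza : z ∈ a) by eauto.
    destruct (L z x Hza Hx) as [K|[K|K]]; auto.
    + subst z. exfalso. revert Hy Hz.
      intros Hy Hz. destruct (set_min (upair x y) x) as (w & Hw & N).
      { apply in_upair; auto. }
      apply in_upair in Hw. destruct Hw as [-> | ->].
      * apply (N y); auto. apply in_upair; auto.
      * apply (N x); auto. apply in_upair; auto.
    + exfalso. destruct (set_min (upair x (upair y z)) x) as (w & Hw & N).
      { apply in_upair; auto. }
      destruct (set_min (cup (sing x) (upair y z)) x) as (v & Hv & N').
      { apply in_cup. left. now apply in_sing. }
      apply in_cup in Hv. rewrite in_sing, in_upair in Hv.
      destruct Hv as [-> | [-> | ->]].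
      * apply (N' y); auto. apply in_cup. rewrite in_upair. auto.
      * apply (N' z); auto. apply in_cup. rewrite in_upair. auto.
      * apply (N' x); auto. apply in_cup. rewrite in_sing. auto.
  - intros y z Hy Hz. apply L; eauto.
Qed.

Lemma ord_sub a b : ord a -> ord b -> a ⊑ b -> a = b \/ a ∈ b.
Proof.
  intros [Ta La] [Tb Lb] H. destruct (classic (a = b)) as [E|E]; auto. right.
  destruct (classic (exists c, c ∈ b /\ ~ c ∈ a)) as [(c0 & Hc0 & Hc0')|N].
  - destruct (set_min (sepf b (fun c => ~ c ∈ a)) c0) as (c & Hc & Hmin).
    { apply in_sepf; [definable|]. auto. }
    apply in_sepf in Hc; [|definable]. destruct Hc as [Hc Hca].
    replace a with c; auto. apply set_ext. intros z. split.
    + intros Hz. apply NNPP. intros N. apply (Hmin z Hz). apply in_sepf; [definable|].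
      split; eauto.
    + intros Hz. destruct (Lb z c (H z Hz) Hc) as [K|[K|K]]; auto.
      * now subst z.
      * exfalso. eauto.
  - exfalso. apply E, set_ext. intros z. split; auto. intros Hz. apply NNPP.
    intros K. eauto.
Qed.

Lemma ord_trichotomy a b : ord a -> ord b -> a ∈ b \/ a = b \/ b ∈ a.
Proof.
  intros Ha Hb. pose (c := sepf a (fun x => x ∈ b)).
  assert (Hc : forall x, x ∈ c <-> x ∈ a /\ x ∈ b) by (intros x;
      apply (in_sepf a (fun x => x ∈ b)); definable).
  assert (Oc : ord c).
  { split.
    - intros x y Hx Hy. apply Hc in Hx. apply Hc. destruct Hx as [H1 H2], Ha, Hb. eauto.
    - intros x y Hx Hy. apply Hc in Hx, Hy. apply Ha; tauto. }
  destruct (ord_sub c a Oc Ha) as [E|E]; [intros z Hz; now apply Hc in Hz | |].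
  - destruct (ord_sub a b Ha Hb) as [K|K]; auto.
    intros z Hz. rewrite <- E in Hz. now apply Hc in Hz.
  - destruct (ord_sub c b Oc Hb) as [K|K]; [intros z Hz; now apply Hc in Hz | |].
    + rewrite K in E. auto.
    + exfalso. apply (in_irrefl c). now apply Hc.
Qed.

Lemma suc_ord a : ord a -> ord (suc a).
Proof.
  intros [T L]. split.
  - intros x y Hx Hy. apply in_suc. left. apply in_suc in Hx.
    destruct Hx as [Hx| ->]; eauto.
  - intros x y Hx Hy. apply in_suc in Hx, Hy.
    destruct Hx as [Hx| ->], Hy as [Hy| ->]; auto.
Qed.

Lemma rk_ord x : ord (rk x).
Proof.
  apply ordb_iff, (ind_Sigma1 (fun x => ordb (rk x))); [definable|]. clear x. intros x IH.
  apply ordb_iff.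
  assert (K : forall z, z ∈ rk x -> exists y, y ∈ x /\ z ∈ suc (rk y)).
  { intros z Hz. apply in_rk in Hz. destruct Hz as (y & Hy & Hz).
    exists y. rewrite in_suc. auto. }
  assert (O : forall y, y ∈ x -> ord (suc (rk y))).
  { intros y Hy. now apply suc_ord, ordb_iff, IH. }
  split.
  - intros z w Hz Hw. destruct (K z Hz) as (y & Hy & Hzy). apply in_rk.
    exists y. split; auto. apply in_suc. destruct (O y Hy) as [T _]. eauto.
  - intros z w Hz Hw. apply ord_trichotomy.
    + destruct (K z Hz) as (y & Hy & Hzy). apply (ord_mem (suc (rk y))); auto.
    + destruct (K w Hw) as (y & Hy & Hzy). apply (ord_mem (suc (rk y))); auto.
Qed.

Lemma rk_of_ord a : ord a -> rk a = a.
Proof.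
  rewrite <- ordb_iff. apply (ind_Sigma1 (fun a => ordb a -> rk a = a)); [definable|].
  clear a. intros a IH Ha. apply set_ext. intros z. rewrite in_rk. rewrite ordb_iff in Ha.
  assert (E : forall y, y ∈ a -> rk y = y).
  { intros y Hy. apply IH; auto. apply ordb_iff. now apply (ord_mem a). }
  split.
  - intros (y & Hy & Hz). rewrite E in Hz by auto. destruct Ha as [T _].
    destruct Hz as [Hz| ->]; eauto.
  - intros Hz. exists z. rewrite E by auto. auto.
Qed.

Lemma rk_mem x y : y ∈ x -> rk y ∈ rk x.
Proof. intros H. apply in_rk. eauto. Qed.

Lemma V_to_rk x y : x ∈ V y -> rk x ∈ rk y.
Proof.
  revert x. apply (ind_Sigma1 (fun y => forall x, x ∈ V y -> rk x ∈ rk y)); [definable|].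
  clear y. intros y IH x Hx. apply in_V in Hx. destruct Hx as (w & Hw & Hx).
  assert (K : rk x ⊑ rk w).
  { intros z Hz. apply in_rk in Hz. destruct Hz as (u & Hu & Hz).
    assert (L : rk u ∈ rk w) by auto. destruct Hz as [Hz| ->]; auto.
    destruct (rk_ord w) as [T _]. eauto. }
  apply in_rk. exists w. split; auto.
  destruct (ord_sub _ _ (rk_ord x) (rk_ord w) K); auto.
Qed.

Lemma rk_to_V x y : rk x ∈ rk y -> x ∈ V y.
Proof.
  intros H. destruct (V_linear x y) as [K|K]; auto. exfalso.
  apply (in_irrefl (rk x)). apply in_rk in H. destruct H as (z & Hz & H).
  apply K, V_to_rk in Hz. destruct (rk_ord x) as [T _].
  destruct H as [H|H]; [exact (T _ _ Hz H) | now rewrite <- H in Hz].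
Qed.

Lemma V_rk x : V (rk x) = V x.
Proof.
  apply set_ext. intros z. split; intros H.
  - apply rk_to_V. apply V_to_rk in H. rewrite (rk_of_ord (rk x)) in H; auto using rk_ord.
  - apply rk_to_V. apply V_to_rk in H. rewrite (rk_of_ord (rk x)); auto using rk_ord.
Qed.

(** ** Ranks as defined by rank functions *)

Lemma is_upair_iff p a b : is_upair M p a b <-> p = upair a b.
Proof.
  unfold is_upair. split.
  - intros H. apply set_ext. intros z. now rewrite H, in_upair.
  - intros -> w. apply in_upair.
Qed.

Lemma is_opair_iff p a b : is_opair M p a b <-> p = opair a b.
Proof.
  unfold is_opair. setoid_rewrite is_upair_iff. split.
  - intros (s & d & -> & -> & ->). reflexivity.
  - intros ->. exists (sing a), (upair a b). auto.
Qed.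

Lemma maps_to_iff f x y : maps_to M f x y <-> opair x y ∈ f.
Proof.
  unfold maps_to. setoid_rewrite is_opair_iff. split.
  - intros (p & Hp & ->). exact Hp.
  - eauto.
Qed.

Lemma has_rank_iff x a : has_rank M x a <-> a = rk x.
Proof.
  split.
  - intros (f & d & (Td & [_ Hf] & Hr) & Hx & Hxa).
    assert (K : forall y, y ∈ d -> opair y (rk y) ∈ f).
    { apply (ind_Sigma1 (fun y => y ∈ d -> opair y (rk y) ∈ f)); [definable|].
      intros y IH Hy. destruct (Hf y Hy) as (b & Hb & _).
      replace (rk y) with b; [now apply maps_to_iff|].
      apply set_ext. intros w. rewrite (Hr y b Hy Hb w), in_rk. split.
      - intros (z & c & Hz & Hc & Hw). exists z. split; auto.
        assert (Hzd : z ∈ d) by exact (Td y z Hy Hz).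
        destruct (Hf z Hzd) as (c' & _ & U).
        assert (c = rk z); [|congruence].
        rewrite <- (U c Hc). apply U. apply maps_to_iff. auto.
      - intros (z & Hz & Hw). exists z, (rk z). split; [|split]; auto.
        apply maps_to_iff, IH; auto. exact (Td y z Hy Hz). }
    destruct (Hf x Hx) as (c & _ & U). rewrite <- (U a Hxa). apply U.
    apply maps_to_iff. auto.
  - intros ->. pose (d := TC (sing x)). pose (f := repl d (fun y => opair y (rk y))).
    assert (F : forall y b, maps_to M f y b <-> y ∈ d /\ b = rk y).
    { intros y b. rewrite maps_to_iff. unfold f. rewrite in_repl by definable. split.
      - intros (z & Hz & E). apply opair_inj in E. destruct E as [-> ->]. auto.
      - intros [Hy ->]. eauto. }
    assert (Hx : x ∈ d) by apply TC_sub, in_sing, eq_refl.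
    exists f, d. split; [|split]; auto; [|apply F; auto].
    split; [|split].
    + intros y z Hy Hz. exact (TC_trans _ y Hy z Hz).
    + split.
      * intros p Hp. apply in_repl in Hp; [|definable]. destruct Hp as (y & Hy & ->).
        exists y, (rk y). split; auto. now apply is_opair_iff.
      * intros y Hy. exists (rk y). split; [apply F; auto|].
        intros b Hb. apply F in Hb. now destruct Hb.
    + intros y b Hy Hb w. apply F in Hb. destruct Hb as [_ ->]. rewrite in_rk. split.
      * intros (z & Hz & Hw). exists z, (rk z). split; [|split]; auto.
        apply F. split; auto. exact (TC_trans _ y Hy z Hz).
      * intros (z & c & Hz & Hc & Hw). apply F in Hc. destruct Hc as [_ ->]. eauto.
Qed.

Lemma rank_le_iff x y : rank_le M x y <-> x ⊑ V y.
Proof.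
  unfold rank_le. setoid_rewrite has_rank_iff. split.
  - intros (a & b & -> & -> & H) z Hz. apply rk_mem in Hz. apply rk_to_V.
    destruct H as [H|H]; [|now rewrite <- H]. destruct (rk_ord y) as [T _]. eauto.
  - intros H. exists (rk x), (rk y). split; [|split]; auto.
    destruct (ord_trichotomy _ _ (rk_ord x) (rk_ord y)) as [K|[K|K]]; auto.
    exfalso. apply rk_to_V in K. apply (V_irrefl y). exact (V_mono _ _ H _ K).
Qed.

Lemma below_rank_iff a x : ord a -> (below_rank M a x <-> x ∈ V a).
Proof.
  intros Ha. unfold below_rank. setoid_rewrite has_rank_iff. split.
  - intros (b & -> & H). apply rk_to_V. now rewrite (rk_of_ord a).
  - intros H. exists (rk x). split; auto. apply V_to_rk in H. now rewrite (rk_of_ord a) in H.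
Qed.

(** Zermelo numerals: they name registers and tag the kinds of clauses. *)
Fixpoint num (k : nat) : M := match k with 0 => emp | S k => sing (num k) end.

Lemma num_inj k l : num k = num l -> k = l.
Proof.
  assert (E : forall x, emp = sing x -> False).
  { intros x H. apply (in_emp x). rewrite H. now apply in_sing. }
  revert l. induction k as [|k IH]; intros [|l] H; cbn in H; auto.
  - now apply E in H.
  - symmetry in H. now apply E in H.
  - f_equal. apply IH. now apply sing_inj.
Qed.

(** * An infinitary logic inside the model *)

Variable xi0 : M.

(** All registers and codes come from this level. *)
Definition Codes := V xi0.

(** The row of index [i] of a relation [t], and replacement of that row by [a].
    Storing the value as a row, instead of as a pair, makes every register have a
    value (initially the empty set) and makes assignments with equal values equal. *)
Lemma row_sig : {row : M -> M -> M | Dfun (fun e => row (e 0) (e 1)) /\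
  forall t i x, x ∈ row t i <-> opair i x ∈ t}.
Proof.
  exists (fun t i => sepf (union (union t)) (fun x => opair i x ∈ t)). split; [definable|].
  intros t i x. rewrite in_sepf by definable. split; [tauto|]. intros H. split; auto.
  apply in_union. exists (upair i x). split; [|apply in_upair; auto].
  apply in_union. exists (opair i x). split; auto. apply in_upair; auto.
Qed.
Definition row := proj1_sig row_sig.
Lemma in_row t i x : x ∈ row t i <-> opair i x ∈ t.
Proof. apply (proj2 (proj2_sig row_sig)). Qed.
Lemma Dfun_row f g : Dfun f -> Dfun g -> Dfun (fun e => row (f e) (g e)).
Proof. apply (Dfun_app2 row), (proj1 (proj2_sig row_sig)). Qed.

Lemma set_row_sig : {set_row : M -> M -> M -> M | Dfun (fun e => set_row (e 0) (e 1) (e 2)) /\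
  forall t i a p, p ∈ set_row t i a <-> (p ∈ t /\ fst p <> i) \/ exists x, x ∈ a /\
      p = opair i x}.
Proof.
  exists (fun t i a => cup (sepf t (fun p => fst p <> i)) (repl a (fun x => opair i x))).
  split; [definable|]. intros t i a p. now rewrite in_cup, in_sepf, in_repl by definable.
Qed.
Definition set_row := proj1_sig set_row_sig.
Lemma in_set_row_gen t i a p :
  p ∈ set_row t i a <-> (p ∈ t /\ fst p <> i) \/ exists x, x ∈ a /\ p = opair i x.
Proof. apply (proj2 (proj2_sig set_row_sig)). Qed.
Lemma Dfun_set_row f g h : Dfun f -> Dfun g -> Dfun h ->
    Dfun (fun e => set_row (f e) (g e) (h e)).
Proof. apply (Dfun_app3 set_row), (proj1 (proj2_sig set_row_sig)). Qed.
Hint Resolve Dfun_row Dfun_set_row : definable.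

Lemma in_set_row t i a j x :
  opair j x ∈ set_row t i a <-> (j = i /\ x ∈ a) \/ (j <> i /\ opair j x ∈ t).
Proof.
  rewrite in_set_row_gen, fst_opair. split.
  - intros [H|(y & Hy & E)]; [tauto|]. apply opair_inj in E. destruct E as [-> ->]. auto.
  - intros [[-> H]|H]; [|tauto]. right. eauto.
Qed.

Lemma row_set_row_eq t i a : row (set_row t i a) i = a.
Proof. apply set_ext. intros z. rewrite in_row, in_set_row. tauto. Qed.
Lemma row_set_row_ne t i a j : j <> i -> row (set_row t i a) j = row t j.
Proof. intros H. apply set_ext. intros z. rewrite !in_row, in_set_row. tauto. Qed.

(** Assignments of subsets of [A] to registers; [assignment] lets [A] be arbitrary, as the
    level of [t] itself contains all values. *)
Definition assignment_in A t := t ∈ pow (prod Codes A).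

Lemma assignment_in_pair A t p : assignment_in A t -> p ∈ t ->
  exists i x, i ∈ Codes /\ x ∈ A /\ p = opair i x.
Proof. unfold assignment_in. rewrite in_pow. intros H Hp. now apply in_prod, H. Qed.

Lemma assignment_in_row A t i : assignment_in A t -> row t i ⊑ A.
Proof.
  intros H x Hx. apply in_row in Hx.
      destruct (assignment_in_pair A t _ H Hx) as (j & y & _ & Hy & E).
  apply opair_inj in E. destruct E as [_ ->]. exact Hy.
Qed.

Lemma assignment_in_set_row A t i a : assignment_in A t -> i ∈ Codes -> a ⊑ A ->
    assignment_in A (set_row t i a).
Proof.
  intros H Hi Ha. apply in_pow. intros p Hp. apply in_set_row_gen in Hp.
  destruct Hp as [[Hp _]|(x & Hx & ->)].
  - unfold assignment_in in H. rewrite in_pow in H. now apply H.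
  - apply opair_in_prod. auto.
Qed.

Lemma assignment_in_self A t : assignment_in A t -> assignment_in (V t) t.
Proof.
  intros H. apply in_pow. intros p Hp.
  destruct (assignment_in_pair A t p H Hp) as (i & x & Hi & _ & ->). apply opair_in_prod.
  split; auto. apply (V_trans t (upair i x)); [|apply in_upair; auto].
  apply (V_trans t (opair i x)); [|apply in_upair; auto]. now apply V_self.
Qed.

Definition assignment t := assignment_in (V t) t.

Lemma assignment_ext t u : assignment t -> assignment u -> (forall i, row t i = row u i) ->
    t = u.
Proof.
  assert (K : forall t u, assignment t -> (forall i, row t i = row u i) -> t ⊑ u).
  { clear t u. intros t u Ht H p Hp.
    destruct (assignment_in_pair _ t p Ht Hp) as (i & x & _ & _ & ->).
    apply in_row. rewrite <- H. now apply in_row. }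
  intros Ht Hu H. apply set_ext. intros p. split; apply K; auto.
Qed.

Lemma assignment_in_emp A : assignment_in A emp.
Proof. apply in_pow. intros z Hz. now apply in_emp in Hz. Qed.
Lemma assignment_emp : assignment emp.
Proof. exact (assignment_in_emp (V emp)). Qed.
Lemma row_emp i : row emp i = emp.
Proof.
  apply set_ext. intros z. rewrite in_row. split; intros H; now apply in_emp in H.
Qed.

Lemma assignment_in_mono A B t : A ⊑ B -> assignment_in A t -> assignment_in B t.
Proof.
  intros H Ht. apply in_pow. intros p Hp.
  destruct (assignment_in_pair A t p Ht Hp) as (i & x & Hi & Hx & ->).
  apply opair_in_prod. auto.
Qed.

Lemma assignment_set_row t i a : assignment t -> i ∈ Codes -> assignment (set_row t i a).
Proof.
  intros Ht Hi. unfold assignment. apply (assignment_in_self (cup (V t) a)).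
      apply assignment_in_set_row; auto.
  - apply (assignment_in_mono (V t)); auto. intros z Hz. apply in_cup; auto.
  - intros z Hz. apply in_cup; auto.
Qed.

Lemma set_row_twice t i a b : assignment t -> i ∈ Codes ->
    set_row (set_row t i a) i b = set_row t i b.
Proof.
  intros Ht Hi. apply assignment_ext; auto using assignment_set_row. intros j.
  destruct (classic (j = i)) as [->|N].
  - now rewrite !row_set_row_eq.
  - now rewrite !row_set_row_ne.
Qed.

Lemma set_row_comm t i j a b : assignment t -> i ∈ Codes -> j ∈ Codes -> i <> j ->
  set_row (set_row t i a) j b = set_row (set_row t j b) i a.
Proof.
  intros Ht Hi Hj N. apply assignment_ext; auto using assignment_set_row. intros k.
  destruct (classic (k = i)) as [->|N1]; [|destruct (classic (k = j)) as [->|N2]].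
  - rewrite row_set_row_ne, !row_set_row_eq; auto.
  - rewrite (row_set_row_ne _ i a j) by auto. now rewrite !row_set_row_eq.
  - now rewrite !row_set_row_ne.
Qed.

Lemma set_row_id t i a : assignment t -> i ∈ Codes -> row t i = a -> set_row t i a = t.
Proof.
  intros Ht Hi E. apply assignment_ext; auto using assignment_set_row. intros j.
  destruct (classic (j = i)) as [->|N];
      [now rewrite row_set_row_eq | now rewrite row_set_row_ne].
Qed.

(** ** Clauses and truth *)

Definition cmem i j := opair (num 0) (opair i j).
Definition ccst i s := opair (num 1) (opair i s).
Definition csub z := opair (num 2) z.
Definition cex i j z := opair (num 3) (opair (opair i j) z).

(** A code [z] is true when none of its clauses is; [H] stands for the truth of the
    codes inside the clause. *)
Definition clause (H : M -> M -> Prop) c t :=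
  (exists i, i ∈ Codes /\ exists j, j ∈ Codes /\ c = cmem i j /\ row t i ∈ row t j) \/
  (exists i, i ∈ Codes /\ exists s, s ∈ Codes /\ c = ccst i s /\ row t i = s) \/
  (exists z, z ∈ Codes /\ c = csub z /\ H z t) \/
  (exists i, i ∈ Codes /\ exists j, j ∈ Codes /\ exists z, z ∈ Codes /\ c = cex i j z /\
     exists a, a ∈ V (row t j) /\ H z (set_row t i a)).

(** Only codes inside [z], and only [t] and its bounded changes, are consulted. *)
Lemma clause_ext H H' z c t : c ∈ z -> assignment t ->
  (forall z' u, z' ∈ TC z -> (u = t \/ exists i a j, i ∈ Codes /\ a ∈ V (row t j) /\
      u = set_row t i a)
     -> (H z' u <-> H' z' u)) ->
  clause H c t -> clause H' c t.
Proof.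
  intros Hc Ht E.
  assert (D : forall k y, opair k y ∈ z -> y ∈ TC z).
  { intros k y K. apply (TC_trans z (upair k y)); [|apply in_upair; auto].
    apply (TC_trans z (opair k y)); [|apply in_upair; auto]. now apply TC_sub. }
  intros [K|[K|[K|K]]].
  - left. exact K.
  - right. left. exact K.
  - right. right. left. destruct K as (w & Hw & -> & K). exists w.
    repeat split; auto. apply E; auto. apply D in Hc. exact Hc.
  - right. right. right. destruct K as (i & Hi & j & Hj & w & Hw & -> & a & Ha & K).
    exists i. split; auto. exists j. split; auto. exists w. repeat split; auto.
    exists a. split; auto. apply E; auto.
    + apply D in Hc. apply (TC_trans z (upair (opair i j) w)); [|apply in_upair; auto].
      apply (TC_trans z _ Hc). apply in_upair; auto.
    + right. exists i, a, j. auto.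
Qed.

Lemma true_in_sig : {true_in : M -> M -> M | Dfun (fun e => true_in (e 0) (e 1)) /\
  forall A z t, t ∈ true_in A z <->
    assignment_in A t /\ forall c, c ∈ z -> ~ clause (fun z t => t ∈ true_in A z) c t}.
Proof.
  destruct (recursion (fun A z f => sepf (pow (prod Codes A))
    (fun t => forall c, c ∈ z -> ~ clause (fun z t => t ∈ lk f z) c t)))
    as (true_in & HF & E).
  { unfold clause, cmem, ccst, csub, cex. definable. }
  exists true_in. split; [exact HF|]. intros A z t.
  destruct (E A z) as (f & -> & Hf). rewrite in_sepf.
  - unfold assignment_in. split; intros [Ht K]; (split; [exact Ht|]); intros c Hc N;
      apply (K c Hc);
      revert N; apply (clause_ext _ _ z c t Hc (assignment_in_self A t Ht));
      intros z' u Hz' _; rewrite (Hf z' Hz'); reflexivity.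
  - unfold clause, cmem, ccst, csub, cex. definable.
Qed.
Definition true_in := proj1_sig true_in_sig.
Lemma in_true_in A z t : t ∈ true_in A z <->
  assignment_in A t /\ forall c, c ∈ z -> ~ clause (fun z t => t ∈ true_in A z) c t.
Proof. apply (proj2 (proj2_sig true_in_sig)). Qed.
Lemma Dfun_true_in f g : Dfun f -> Dfun g -> Dfun (fun e => true_in (f e) (g e)).
Proof. apply (Dfun_app2 true_in), (proj1 (proj2_sig true_in_sig)). Qed.
Hint Resolve Dfun_true_in : definable.

(** Truth does not depend on the level from which values are drawn, since all
    quantifiers are bounded by the rank of a register. *)
Lemma true_in_agree x y z t : assignment_in (V x) t -> assignment_in (V y) t ->
  (t ∈ true_in (V x) z <-> t ∈ true_in (V y) z).
Proof.
  assert (S : forall x y z t, assignment_in (V x) t -> assignment_in (V y) t ->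
    (forall z', z' ∈ TC z -> forall u, assignment_in (V x) u -> assignment_in (V y) u ->
       (u ∈ true_in (V x) z' <-> u ∈ true_in (V y) z')) ->
    t ∈ true_in (V x) z -> t ∈ true_in (V y) z).
  { clear x y z t. intros x y z t Hx Hy IH Ht. apply in_true_in in Ht. apply in_true_in.
    destruct Ht as [_ Ht]. split; auto. intros c Hc N. apply (Ht c Hc).
    revert N. apply (clause_ext _ _ z c t Hc (assignment_in_self _ t Hx)).
    intros z' u Hz' Hu. symmetry. destruct Hu as [->|(i & a & j & Hi & Ha & ->)].
    - now apply IH.
    - assert (B : forall w, assignment_in (V w) t -> a ⊑ V w).
      { intros w Hw b Hb. apply (V_trans w a); auto.
        apply (V_mono w (row t j)); auto. now apply assignment_in_row. }
      apply IH; auto using assignment_in_set_row. }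
  revert t.
  apply (ind_TC_Pi1 (fun z => forall t, t ∈ pow (prod Codes (V x)) ->
      t ∈ pow (prod Codes (V y)) ->
    (t ∈ true_in (V x) z <-> t ∈ true_in (V y) z))); [definable|].
  clear z. intros z IH t Hx Hy. split; apply S; auto.
  intros z' Hz' u H1 H2. symmetry. now apply IH.
Qed.

Definition holds z t := t ∈ true_in (V t) z.

Lemma Delta1_holds f g : Dfun f -> Dfun g -> Delta1 (fun e => holds (f e) (g e)).
Proof. intros. unfold holds. definable. Qed.
Hint Resolve Delta1_holds : definable.

Lemma holds_iff z t : assignment t -> (holds z t <-> forall c, c ∈ z -> ~ clause holds c t).
Proof.
  intros Ht. unfold holds at 1. rewrite in_true_in.
  assert (E : forall u, (u = t \/ exists i a j, i ∈ Codes /\ a ∈ V (row t j) /\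
      u = set_row t i a) ->
    forall z', u ∈ true_in (V t) z' <-> holds z' u).
  { intros u Hu z'.
    assert (assignment_in (V t) u).
    { destruct Hu as [->|(i & a & j & Hi & Ha & ->)]; auto. apply assignment_in_set_row; auto.
      intros b Hb. apply (V_trans t a); auto. apply (V_mono t (row t j)); auto.
      now apply assignment_in_row. }
    apply true_in_agree; auto. now apply (assignment_in_self (V t)). }
  split.
  - intros [_ K] c Hc N. apply (K c Hc). revert N. apply (clause_ext _ _ z); auto.
    intros z' u _ Hu. symmetry. auto.
  - intros K. split; auto. intros c Hc N. apply (K c Hc). revert N.
    apply (clause_ext _ _ z); auto.
Qed.

Ltac tags H :=
  unfold cmem, ccst, csub, cex in H;
  match type of H with
  | opair (num ?k) _ = opair (num ?l) _ =>
      let E := fresh in destruct (opair_inj _ _ _ _ H) as [E _]; apply num_inj in E;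
          discriminate
  end.

Lemma clause_cmem H i j t : i ∈ Codes -> j ∈ Codes ->
  (clause H (cmem i j) t <-> row t i ∈ row t j).
Proof.
  intros Hi Hj. split.
  - intros [K|[K|[K|K]]].
    + destruct K as (i' & _ & j' & _ & E & K).
      apply opair_inj in E. destruct E as [_ E]. apply opair_inj in E.
      destruct E as [-> ->]. exact K.
    + destruct K as (? & _ & ? & _ & E & _). tags E.
    + destruct K as (? & _ & E & _). tags E.
    + destruct K as (? & _ & ? & _ & ? & _ & E & _). tags E.
  - intros K. left. eauto 8.
Qed.

Lemma clause_ccst H i s t : i ∈ Codes -> s ∈ Codes ->
  (clause H (ccst i s) t <-> row t i = s).
Proof.
  intros Hi Hj. split.
  - intros [K|[K|[K|K]]].
    + destruct K as (? & _ & ? & _ & E & _). tags E.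
    + destruct K as (i' & _ & j' & _ & E & K).
      apply opair_inj in E. destruct E as [_ E]. apply opair_inj in E.
      destruct E as [-> ->]. exact K.
    + destruct K as (? & _ & E & _). tags E.
    + destruct K as (? & _ & ? & _ & ? & _ & E & _). tags E.
  - intros K. right. left. eauto 8.
Qed.

Lemma clause_csub H z t : z ∈ Codes -> (clause H (csub z) t <-> H z t).
Proof.
  intros Hz. split.
  - intros [K|[K|[K|K]]].
    + destruct K as (? & _ & ? & _ & E & _). tags E.
    + destruct K as (? & _ & ? & _ & E & _). tags E.
    + destruct K as (z' & _ & E & K). apply opair_inj in E. destruct E as [_ ->]. exact K.
    + destruct K as (? & _ & ? & _ & ? & _ & E & _). tags E.
  - intros K. right. right. left. eauto.
Qed.

Lemma clause_cex H i j z t : i ∈ Codes -> j ∈ Codes -> z ∈ Codes ->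
  (clause H (cex i j z) t <-> exists a, a ∈ V (row t j) /\ H z (set_row t i a)).
Proof.
  intros Hi Hj Hz. split.
  - intros [K|[K|[K|K]]].
    + destruct K as (? & _ & ? & _ & E & _). tags E.
    + destruct K as (? & _ & ? & _ & E & _). tags E.
    + destruct K as (? & _ & E & _). tags E.
    + destruct K as (i' & _ & j' & _ & z' & _ & E & K).
      apply opair_inj in E. destruct E as [_ E]. apply opair_inj in E.
      destruct E as [E ->]. apply opair_inj in E. destruct E as [-> ->]. exact K.
  - intros K. right. right. right. exists i. split; auto. exists j. split; auto.
    exists z. auto.
Qed.

Lemma holds_sing c t : assignment t -> (holds (sing c) t <-> ~ clause holds c t).
Proof.
  intros Ht. rewrite holds_iff by auto. split.
  - intros H. apply H. now apply in_sing.
  - intros H d Hd. apply in_sing in Hd. now subst d.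
Qed.

(** ** Agreement up to a level *)

Definition agree xi t u := forall z, z ∈ V xi -> (holds z t <-> holds z u).
Definition type_upto xi t := sepf (V xi) (fun z => holds z t).

Lemma Dfun_type_upto f g : Dfun f -> Dfun g -> Dfun (fun e => type_upto (f e) (g e)).
Proof. apply (Dfun_app2 type_upto). change (Dfun (fun e => type_upto (e 0) (e 1))).
    unfold type_upto. definable. Qed.
Hint Resolve Dfun_type_upto : definable.

Lemma in_type_upto xi t z : z ∈ type_upto xi t <-> z ∈ V xi /\ holds z t.
Proof. unfold type_upto. rewrite in_sepf; [tauto | definable]. Qed.

Lemma type_upto_agree xi t u : type_upto xi t = type_upto xi u <-> agree xi t u.
Proof.
  split.
  - intros E z Hz. split; intros K.
    + apply (in_type_upto xi u). rewrite <- E. now apply in_type_upto.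
    + apply (in_type_upto xi t). rewrite E. now apply in_type_upto.
  - intros E. apply set_ext. intros z. rewrite !in_type_upto. split; intros [H K]; split; auto;
      now apply E.
Qed.

Lemma agree_refl xi t : agree xi t t.
Proof. intros z _. tauto. Qed.
Lemma agree_sym xi t u : agree xi t u -> agree xi u t.
Proof. intros H z Hz. now rewrite (H z Hz). Qed.
Lemma agree_trans xi t u v : agree xi t u -> agree xi u v -> agree xi t v.
Proof. intros H K z Hz. now rewrite (H z Hz), (K z Hz). Qed.
Lemma agree_mono xi xi' t u : V xi ⊑ V xi' -> agree xi' t u -> agree xi t u.
Proof. intros H K z Hz. apply K, H, Hz. Qed.

Fixpoint sings (k : nat) x := match k with 0 => x | S k => sing (sings k x) end.

Lemma V_sing_sub x : V x ⊑ V (sing x).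
Proof. intros z Hz. apply in_V_sing. intros w. exact (V_trans x z Hz w). Qed.

Lemma V_sings_mono k l x : k <= l -> V (sings k x) ⊑ V (sings l x).
Proof.
  induction 1; auto. intros z Hz. cbn. apply V_sing_sub. auto.
Qed.

Lemma sing_V k x y : y ∈ V (sings k x) -> sing y ∈ V (sings (S k) x).
Proof.
  intros H. cbn. apply in_V_sing. intros z Hz. apply in_sing in Hz. now subst z.
Qed.

Lemma opair_V k x y z : y ∈ V (sings k x) -> z ∈ V (sings k x) ->
    opair y z ∈ V (sings (S (S k)) x).
Proof.
  intros Hy Hz. cbn. apply in_V_sing. intros w Hw. apply in_upair in Hw.
  apply in_V_sing. intros v Hv.
  destruct Hw as [-> | ->]; [apply in_sing in Hv | apply in_upair in Hv].
  - now subst v.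
  - destruct Hv as [-> | ->]; auto.
Qed.

(** Twelve power sets leave room for [char_code] and a quantified clause around it. *)
Definition far xi xi' := V (sings 12 xi) ⊑ V xi'.

Definition numerals xi := forall k, num k ∈ V xi.

Section Move.
Variables xi xi' : M.
Hypothesis Hnm : numerals xi.
Hypothesis Hfar : far xi xi'.
Hypothesis Hxi' : V xi' ⊑ Codes.

Lemma level_Codes k : k <= 12 -> V (sings k xi) ⊑ Codes.
Proof. intros H z Hz. apply Hxi', Hfar. revert z Hz. now apply V_sings_mono. Qed.

Lemma level_up k l z : k <= l -> z ∈ V (sings k xi) -> z ∈ V (sings l xi).
Proof. intros H. now apply V_sings_mono. Qed.

(** One code says everything that holds of [t] up to level [xi]: the two kinds
    of clauses are the negations of the false codes and the double negations of
    the true ones. *)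
Definition char_code t := cup (repl (sepf (V xi) (fun z => ~ holds z t)) csub)
  (repl (type_upto xi t) (fun z => csub (sing (csub z)))).

Lemma char_code_V t : char_code t ∈ V (sings 6 xi).
Proof.
  apply in_V_sing. intros c Hc. apply in_cup in Hc.
  assert (N : forall k l, num l ∈ V (sings k xi)).
  { intros k l. apply (level_up 0); [lia | apply Hnm]. }
  destruct Hc as [Hc|Hc].
  - apply in_repl in Hc; [|unfold csub; definable]. destruct Hc as (z & Hz & ->).
    apply in_sepf in Hz; [|definable]. destruct Hz as [Hz _].
    apply (level_up 2 5); [lia|]. apply (opair_V 0); auto.
  - apply in_repl in Hc; [|unfold csub; definable]. destruct Hc as (z & Hz & ->).
    apply in_type_upto in Hz. destruct Hz as [Hz _].
    apply (opair_V 3); auto. apply sing_V. apply (opair_V 0); auto.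
Qed.

Lemma char_code_iff t u : assignment u -> (holds (char_code t) u <-> agree xi t u).
Proof.
  intros Hu. rewrite holds_iff by auto.
  assert (N0 : forall z, z ∈ V xi -> z ∈ Codes) by (apply (level_Codes 0); lia).
  assert (N3 : forall z, z ∈ V xi -> sing (csub z) ∈ Codes).
  { intros z Hz. apply (level_Codes 3); [lia|]. apply sing_V. apply (opair_V 0); auto. }
  split.
  - intros H z Hz. split; intros K.
    + apply NNPP. intros N. apply (H (csub (sing (csub z)))).
      * apply in_cup. right. apply in_repl; [unfold csub; definable|]. exists z.
        split; auto. now apply in_type_upto.
      * apply clause_csub; auto. apply holds_sing; auto. now rewrite clause_csub by auto.
    + apply NNPP. intros N. apply (H (csub z)).
      * apply in_cup. left. apply in_repl; [unfold csub; definable|]. exists z. split; auto.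
        apply in_sepf; [definable|]. auto.
      * apply clause_csub; auto.
  - intros E c Hc K. apply in_cup in Hc. destruct Hc as [Hc|Hc].
    + apply in_repl in Hc; [|unfold csub; definable]. destruct Hc as (z & Hz & ->).
      apply in_sepf in Hz; [|definable]. destruct Hz as [Hz N].
      rewrite clause_csub in K by auto. exact (N (proj2 (E z Hz) K)).
    + apply in_repl in Hc; [|unfold csub; definable]. destruct Hc as (z & Hz & ->).
      apply in_type_upto in Hz. destruct Hz as [Hz N].
      rewrite clause_csub in K by auto. rewrite holds_sing in K by auto.
      rewrite clause_csub in K by auto. exact (K (proj1 (E z Hz) N)).
Qed.

(** If no answer existed, then the formula saying that some value of register [i]
    has the type of [a] would separate [t] from [u]. *)
Lemma agree_move t u i j a : assignment t -> assignment u -> i ∈ V xi -> j ∈ V xi ->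
    agree xi' t u ->
  a ∈ V (row t j) -> exists b, b ∈ V (row u j) /\ agree xi (set_row t i a) (set_row u i b).
Proof.
  intros Ht Hu Hi Hj E Ha.
  assert (Hi' : i ∈ Codes) by (apply (level_Codes 0); auto; lia).
  assert (Hj' : j ∈ Codes) by (apply (level_Codes 0); auto; lia).
  pose (z := char_code (set_row t i a)).
  assert (Hz : z ∈ Codes) by (apply (level_Codes 6); [lia | apply char_code_V]).
  assert (C : sing (cex i j z) ∈ V xi').
  { apply Hfar, (level_up 11); [lia|]. apply sing_V.
    apply (opair_V 8); [apply (level_up 0); [lia | apply Hnm]|].
    apply (opair_V 6); [|apply char_code_V].
    apply (level_up 2); [lia|]. now apply (opair_V 0). }
  specialize (E _ C). rewrite !holds_sing, !clause_cex in E by auto.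
  destruct (classic (exists b, b ∈ V (row u j) /\ holds z (set_row u i b))) as [(b & Hb & K)|N].
  - exists b. split; auto. apply char_code_iff in K; auto. now apply assignment_set_row.
  - exfalso. rewrite <- E in N. apply N. exists a. split; auto.
    apply char_code_iff; [now apply assignment_set_row | apply agree_refl].
Qed.

Lemma agree_mem t u i j : assignment t -> assignment u -> i ∈ V xi -> j ∈ V xi ->
    agree xi' t u ->
  (row t i ∈ row t j <-> row u i ∈ row u j).
Proof.
  intros Ht Hu Hi Hj E.
  assert (Hi' : i ∈ Codes) by (apply (level_Codes 0); auto; lia).
  assert (Hj' : j ∈ Codes) by (apply (level_Codes 0); auto; lia).
  assert (C : sing (cmem i j) ∈ V xi').
  { apply Hfar, (level_up 5); [lia|]. apply sing_V.
    apply (opair_V 2); [apply (level_up 0); [lia | apply Hnm]|]. now apply (opair_V 0). }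
  specialize (E _ C). rewrite !holds_sing, !clause_cmem in E by auto. tauto.
Qed.

Lemma agree_cst t u i s : assignment t -> assignment u -> i ∈ V xi -> s ∈ V xi ->
    agree xi' t u ->
  (row t i = s <-> row u i = s).
Proof.
  intros Ht Hu Hi Hj E.
  assert (Hi' : i ∈ Codes) by (apply (level_Codes 0); auto; lia).
  assert (Hj' : s ∈ Codes) by (apply (level_Codes 0); auto; lia).
  assert (C : sing (ccst i s) ∈ V xi').
  { apply Hfar, (level_up 5); [lia|]. apply sing_V.
    apply (opair_V 2); [apply (level_up 0); [lia | apply Hnm]|]. now apply (opair_V 0). }
  specialize (E _ C). rewrite !holds_sing, !clause_ccst in E by auto. tauto.
Qed.
End Move.

(** Only set many types are realized, so by Separation and Collection some
    level realizes them all. *)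
Lemma complete_ex Q g xi : exists gam, forall t, t ∈ Q -> forall x,
  exists x', x' ∈ V gam /\ agree xi (set_row t g x) (set_row t g x').
Proof.
  destruct (separation_Sigma1 (fun p => exists t, t ∈ Q /\ exists x,
    p = opair t (type_upto xi (set_row t g x))) (prod Q (pow (V xi)))) as [W HW]; [definable|].
  destruct (collection_Sigma1 (fun p x => exists t, t ∈ Q /\
      p = opair t (type_upto xi (set_row t g x))) W)
    as [B HB]; [definable | |].
  - intros p Hp. apply HW in Hp. destruct Hp as (_ & t & Ht & x & ->). eauto.
  - exists B. intros t Ht x.
    destruct (HB (opair t (type_upto xi (set_row t g x)))) as (x' & Hx' & t' & _ & E).
    + apply HW. split; [|eauto]. apply opair_in_prod. split; auto.
      apply in_pow. intros z Hz. now apply in_type_upto in Hz.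
    + exists x'. split; [now apply V_self|]. apply opair_inj in E.
      destruct E as [<- E]. now apply type_upto_agree.
Qed.

(** * The back-and-forth invariant *)

(** ** Levels outside the cut *)

Variable Cut : M -> Prop.
Hypothesis hS : is_rank_cut_of M Cut.
Hypothesis hxi0 : ~ Cut xi0.

Lemma cut_rank x y : Cut x -> y ⊑ V x -> Cut y.
Proof.
  intros Hx H. destruct hS as (_ & Hi & _).
  destruct (Hi (exist _ x Hx) y) as [[z Hz] E].
  - apply rank_le_iff. exact H.
  - cbn in E. now subst z.
Qed.

Lemma cut_bounded : exists a, ~ Cut a.
Proof.
  destruct hS as (_ & _ & (a & Ha & K) & _). exists a. intros H.
  specialize (K (exist _ a H)). apply below_rank_iff in K; auto. now apply V_irrefl in K.
Qed.

Lemma outside_ord a : is_ord M a -> ~ Cut a -> exists b, is_ord M b /\ ~ Cut b /\ b ∈ a.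
Proof.
  intros Ha N. destruct hS as (_ & _ & _ & K). destruct (K a Ha) as (b & Hb & Nb & Hba).
  - intros [[x Hx] E]. cbn in E. now subst x.
  - exists b. repeat split; try apply Hb; auto. intros Sb. apply Nb.
    exists (exist _ b Sb). reflexivity.
Qed.

Lemma outside_pred xi : ~ Cut xi -> exists xi1, ~ Cut xi1 /\ xi1 ∈ V xi.
Proof.
  intros H. destruct (outside_ord (rk xi)) as (b & Hb & Nb & K).
  - apply rk_ord.
  - intros N. apply H, (cut_rank (rk xi)); auto. rewrite V_rk. apply V_self.
  - exists b. split; auto. rewrite <- V_rk. now apply V_self.
Qed.

Lemma cut_in_V s xi : Cut s -> ~ Cut xi -> s ∈ V xi.
Proof.
  intros holds N. destruct (V_linear s xi) as [H|H]; auto. exfalso. apply N.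
  now apply (cut_rank s).
Qed.

Lemma V_comparable x y : V x ⊑ V y \/ V y ⊑ V x.
Proof.
  destruct (V_linear x y) as [H|H]; [left; now apply V_mono_in | right; now apply V_mono].
Qed.

Lemma cut_num k : Cut (num k).
Proof.
  induction k as [|k IH]; apply NNPP; intros N;
    apply outside_pred in N; destruct N as (x & Nx & Hx).
  - apply in_V in Hx. destruct Hx as (y & Hy & _). now apply in_emp in Hy.
  - apply Nx, (cut_rank (num k)); auto. now apply in_V_sing.
Qed.

Lemma V_sings_mono_index k x y : V x ⊑ V y -> V (sings k x) ⊑ V (sings k y).
Proof.
  intros H. induction k as [|k IH]; auto. intros z Hz. cbn in *.
  apply in_V_sing. intros w Hw. apply IH. revert w Hw. now apply in_V_sing.
Qed.

Lemma sings_comm k x : sings k (sing x) = sings (S k) x.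
Proof. induction k as [|k IH]; cbn in *; congruence. Qed.

Lemma outside_sings k xi' : ~ Cut xi' -> exists xi, ~ Cut xi /\ V (sings k xi) ⊑ V xi'.
Proof.
  revert xi'. induction k as [|k IH]; intros xi' H; [exists xi'; auto|].
  destruct (IH xi' H) as (x & Nx & K). destruct (outside_pred x Nx) as (y & Ny & Hy).
  exists y. split; auto. rewrite <- sings_comm. intros z Hz. apply K. revert z Hz.
  apply V_sings_mono_index. intros z Hz. apply (V_sub_closed x (V y)); [now apply V_in|].
  now apply in_V_sing.
Qed.

(** There is no lowest such level ([small_far]), and each contains the cut
    ([small_cut]). *)
Definition small xi := ~ Cut xi /\ V xi ⊑ Codes.

Lemma small_xi0 : small xi0.
Proof. split; [exact hxi0 | auto]. Qed.

Lemma small_far xi' : small xi' -> exists xi, small xi /\ far xi xi'.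
Proof.
  intros [N H]. destruct (outside_sings 12 xi' N) as (xi & Nxi & K).
  exists xi. repeat split; auto. intros z Hz. apply H, K.
  revert z Hz. apply (V_sings_mono 0 12). lia.
Qed.

Lemma small_min a b : small a -> ~ Cut b -> exists c, small c /\ V c ⊑ V a /\ V c ⊑ V b.
Proof.
  intros [Na Ha] Nb. destruct (V_comparable a b) as [H|H].
  - exists a. repeat split; auto.
  - exists b. repeat split; auto.
Qed.

Lemma small_cut s xi : Cut s -> small xi -> s ∈ V xi.
Proof. intros H [N _]. now apply cut_in_V. Qed.
Lemma small_num k xi : small xi -> num k ∈ V xi.
Proof. apply small_cut, cut_num. Qed.
Lemma num_Codes k : num k ∈ Codes.
Proof. apply small_num, small_xi0. Qed.
Hint Resolve small_num num_Codes assignment_set_row : core.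

Lemma small_numerals xi : small xi -> numerals xi.
Proof. intros H k. auto. Qed.

Lemma small_move xi xi' t u i j a : small xi -> small xi' -> far xi xi' -> assignment t ->
    assignment u ->
  agree xi' t u -> a ∈ V (row t (num j)) ->
  exists b, b ∈ V (row u (num j)) /\ agree xi (set_row t (num i) a) (set_row u (num i) b).
Proof.
  intros H [_ H'] F Ht Hu E Ha.
  apply (agree_move xi xi' (small_numerals _ H) F H' t u (num i) (num j) a); auto.
Qed.

(** ** The invariant and its extension steps *)

(** The register [num 0] is the scratch register over which the invariant
    quantifies; the others record the map. *)
Definition good t u del := exists xi, small xi /\ forall x, exists y,
  y ∈ V del /\ agree xi (set_row t (num 0) x) (set_row u (num 0) y).

Definition complete xi t gam := forall x, exists x',
  x' ∈ V gam /\ agree xi (set_row t (num 0) x) (set_row t (num 0) x').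

Lemma V_incl x y : x ⊑ y -> V x ⊑ V y.
Proof. intros H. apply V_mono. intros z Hz. apply V_self. auto. Qed.

Lemma complete_mono xi t gam gam' : V gam ⊑ V gam' -> complete xi t gam -> complete xi t gam'.
Proof. intros H K x. destruct (K x) as (x' & Hx' & E). eauto. Qed.

Lemma complete_single xi t : exists gam, complete xi t gam.
Proof.
  destruct (complete_ex (sing t) (num 0) xi) as [gam H]. exists gam.
  intros x. apply H. now apply in_sing.
Qed.

Lemma good_mono t u del del' : V del ⊑ V del' -> good t u del -> good t u del'.
Proof.
  intros H (xi & Hxi & K). exists xi. split; auto. intros x.
  destruct (K x) as (y & Hy & E). eauto.
Qed.

Lemma good_trans t u v gam del : good t u gam -> good u v del -> good t v del.
Proof.
  intros (xi & Hxi & H) (xi' & Hxi' & K).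
  destruct (small_min xi xi' Hxi (proj1 Hxi')) as (e & He & E1 & E2).
  exists e. split; auto. intros x. destruct (H x) as (y & _ & F).
  destruct (K y) as (z & Hz & G). exists z. split; auto.
  apply (agree_trans _ _ (set_row u (num 0) y)).
  - now apply (agree_mono e xi).
  - now apply (agree_mono e xi').
Qed.

(** A complete level in the scratch register answers for all of its contents. *)
Lemma good_of_agree xi xi' t u gam del : small xi -> small xi' -> far xi xi' ->
  assignment t -> assignment u -> complete xi t gam ->
  agree xi' (set_row t (num 0) gam) (set_row u (num 0) del) -> good t u del.
Proof.
  intros H H' F Ht Hu C E. exists xi. split; auto. intros x.
  destruct (C x) as (x' & Hx' & K).
  destruct (small_move xi xi' _ _ 0 0 x' H H' F (assignment_set_row _ _ _ Ht (num_Codes 0))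
    (assignment_set_row _ _ _ Hu (num_Codes 0)) E) as (y & Hy & L).
  - now rewrite row_set_row_eq.
  - rewrite row_set_row_eq in Hy. exists y. split; auto.
    rewrite !set_row_twice in L by auto. now apply (agree_trans _ _ _ _ K).
Qed.

(** The answer to a complete level is again an admissible bound, so none is
    least. *)
Lemma good_lower t u del : assignment t -> assignment u -> good t u del ->
  exists del', del' ∈ V del /\ good t u del'.
Proof.
  intros Ht Hu (xi & Hxi & K). destruct (small_far xi Hxi) as (xi1 & H1 & F1).
  destruct (complete_single xi1 t) as [gam C].
  destruct (K gam) as (d & Hd & E). exists d. split; auto.
  now apply (good_of_agree xi1 xi t u gam).
Qed.

Lemma num_ne k l : k <> l -> num k <> num l.
Proof. intros H E. apply H. now apply num_inj. Qed.
Hint Resolve num_ne : core.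

(** A level that is complete for all the changed assignments at once is chosen
    before the element, so that the move for the element can be made on either
    side. *)
Lemma good_both t u del k j : assignment t -> assignment u -> good t u del -> k <> 0 ->
    j <> 0 ->
  (forall a, a ∈ V (row t (num j)) -> exists b, b ∈ V (row u (num j)) /\
     good (set_row t (num k) a) (set_row u (num k) b) del) /\
  (forall b, b ∈ V (row u (num j)) -> exists a, a ∈ V (row t (num j)) /\
     good (set_row t (num k) a) (set_row u (num k) b) del).
Proof.
  intros Ht Hu (xi & Hxi & K) Hk Hj.
  destruct (small_far xi Hxi) as (xi1 & H1 & F1).
  destruct (small_far xi1 H1) as (xi2 & H2 & F2).
  destruct (complete_ex (repl (V (row t (num j))) (fun a => set_row t (num k) a)) (num 0) xi2)
    as [gam C].
  assert (C' : forall a, a ∈ V (row t (num j)) -> complete xi2 (set_row t (num k) a) gam).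
  { intros a Ha x. apply C. apply in_repl; [definable|]. eauto. }
  destruct (K gam) as (d & Hd & E).
  assert (G : forall a b, a ∈ V (row t (num j)) ->
    agree xi1 (set_row (set_row t (num 0) gam) (num k) a) (set_row (set_row u (num 0) d) (num
        k) b) ->
    good (set_row t (num k) a) (set_row u (num k) b) del).
  { intros a b Ha L. apply (good_mono _ _ d); [now apply V_mono_in|].
    rewrite (set_row_comm t), (set_row_comm u) in L by auto.
    apply (good_of_agree xi2 xi1 _ _ gam); auto. }
  split.
  - intros a Ha.
    destruct (small_move xi1 xi (set_row t (num 0) gam) (set_row u (num 0) d) k j a) as (b & Hb
        & L); auto.
    + now rewrite row_set_row_ne by auto.
    + rewrite row_set_row_ne in Hb by auto. exists b. auto.
  - intros b Hb.
    destruct (small_move xi1 xi (set_row u (num 0) d) (set_row t (num 0) gam) k j b) as (a & Ha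
        & L);
      auto using agree_sym.
    + now rewrite row_set_row_ne by auto.
    + rewrite row_set_row_ne in Ha by auto. exists a. split; auto. apply G; auto.
      now apply agree_sym.
Qed.

Lemma emp_in_V x c : c ∈ x -> emp ∈ V x.
Proof. intros H. apply in_V. exists c. split; auto. intros z Hz. now apply in_emp in Hz. Qed.

(** The new register receives a complete level [rho], so that its answer [pi] is an
    admissible bound for the old assignments. *)
Lemma good_raise t u del k c : assignment t -> assignment u -> good t u del -> k <> 0 ->
  row t (num k) = emp -> row u (num k) = emp ->
  exists rho pi, c ∈ V rho /\ good (set_row t (num k) rho) (set_row u (num k) pi) del /\
      good t u pi.
Proof.
  intros Ht Hu (xi & Hxi & K) Hk Et Eu.
  destruct (small_far xi Hxi) as (xi1 & H1 & F1).
  destruct (small_far xi1 H1) as (xi2 & H2 & F2).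
  destruct (small_far xi2 H2) as (xi3 & H3 & F3).
  destruct (small_far xi3 H3) as (xi4 & H4 & F4).
  destruct (complete_single xi3 t) as [gam0 C0].
  pose (rho := cup gam0 (sing c)).
  assert (Hc : c ∈ rho) by (apply in_cup; right; now apply in_sing).
  assert (C1 : complete xi3 t rho).
  { apply (complete_mono _ _ gam0); auto. apply V_incl. intros z Hz. apply in_cup. auto. }
  destruct (complete_single xi2 (set_row t (num k) rho)) as [gam1 C2].
  pose (gam := cup gam1 (sing rho)).
  assert (Hrho : rho ∈ gam) by (apply in_cup; right; now apply in_sing).
  assert (C3 : complete xi2 (set_row t (num k) rho) gam).
  { apply (complete_mono _ _ gam1); auto. apply V_incl. intros z Hz. apply in_cup. auto. }
  clearbody rho gam. clear gam0 gam1 C0 C2.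
  destruct (K gam) as (d & Hd & E).
  destruct (small_move xi1 xi (set_row t (num 0) gam) (set_row u (num 0) d) k 0 rho) as (pi &
      Hpi & L); auto.
  { rewrite row_set_row_eq. now apply V_self. }
  rewrite (set_row_comm t), (set_row_comm u) in L by auto.
  exists rho, pi. split; [now apply V_self|]. split.
  - apply (good_mono _ _ d); [now apply V_mono_in|].
    apply (good_of_agree xi2 xi1 _ _ gam); auto.
  - exists xi3. split; auto. intros x. destruct (C1 x) as (x' & Hx' & Ex).
    destruct (small_move xi2 xi1 _ _ 0 k x' H2 H1 F2
      (assignment_set_row _ _ gam (assignment_set_row _ _ rho Ht (num_Codes k)) (num_Codes 0))
      (assignment_set_row _ _ d (assignment_set_row _ _ pi Hu (num_Codes k)) (num_Codes 0)) L)
          as (y & Hy & L2).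
    { now rewrite row_set_row_ne, row_set_row_eq by auto. }
    rewrite row_set_row_ne, row_set_row_eq in Hy by auto.
    rewrite !set_row_twice in L2 by auto.
    (* Emptying register [k] again on the left must be answered by emptying it
       on the right, as the empty set is named. *)
    destruct (small_move xi3 xi2 _ _ k k emp H3 H2 F3
      (assignment_set_row _ _ x' (assignment_set_row _ _ rho Ht (num_Codes k)) (num_Codes 0))
      (assignment_set_row _ _ y (assignment_set_row _ _ pi Hu (num_Codes k)) (num_Codes 0)) L2)
          as (b & Hb & L3).
    { rewrite row_set_row_ne, row_set_row_eq by auto. now apply (emp_in_V _ c). }
    assert (b = emp) as ->.
    { rewrite <- (row_set_row_eq (set_row (set_row u (num k) pi) (num 0) y) (num k) b).
      apply (agree_cst xi4 xi3 (small_numerals _ H4) F4 (proj2 H3)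
        (set_row (set_row (set_row t (num k) rho) (num 0) x') (num k) emp)
        (set_row (set_row (set_row u (num k) pi) (num 0) y) (num k) b) (num k) emp); auto.
      - apply (small_num 0); auto.
      - apply row_set_row_eq. }
    assert (R : forall v w z, assignment v -> row v (num k) = emp ->
      set_row (set_row (set_row v (num k) w) (num 0) z) (num k) emp = set_row v (num 0) z).
    { intros v w z Hv Ev. rewrite (set_row_comm v), set_row_twice by auto.
      apply set_row_id; auto. now rewrite row_set_row_ne by auto. }
    rewrite !R in L3 by auto. exists y. split; auto.
    now apply (agree_trans _ _ _ _ Ex).
Qed.

Lemma good_agree t u del : good t u del ->
  exists xi xi', small xi /\ small xi' /\ far xi xi' /\ forall x, exists y,
    y ∈ V del /\ agree xi' (set_row t (num 0) x) (set_row u (num 0) y).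
Proof.
  intros (xi & Hxi & K). destruct (small_far xi Hxi) as (xi1 & H1 & F1).
  exists xi1, xi. auto.
Qed.

Lemma good_mem t u del k l : assignment t -> assignment u -> good t u del -> k <> 0 -> l <> 0 ->
  (row t (num k) ∈ row t (num l) <-> row u (num k) ∈ row u (num l)).
Proof.
  intros Ht Hu G Hk Hl. destruct (good_agree _ _ _ G) as (xi & xi' & H & H' & F & K).
  destruct (K emp) as (y & _ & E).
  pose proof (agree_mem xi xi' (small_numerals _ H) F (proj2 H') _ _ (num k) (num l)
    (assignment_set_row _ _ emp Ht (num_Codes 0)) (assignment_set_row _ _ y Hu (num_Codes 0))
    (small_num _ _ H) (small_num _ _ H) E) as L.
  now rewrite !row_set_row_ne in L by auto.
Qed.

Lemma good_fix t u del k : assignment t -> assignment u -> good t u del -> k <> 0 ->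
  Cut (row t (num k)) -> row u (num k) = row t (num k).
Proof.
  intros Ht Hu G Hk HS. destruct (good_agree _ _ _ G) as (xi & xi' & H & H' & F & K).
  destruct (K emp) as (y & _ & E).
  pose proof (agree_cst xi xi' (small_numerals _ H) F (proj2 H') _ _ (num k) (row t (num k))
    (assignment_set_row _ _ emp Ht (num_Codes 0)) (assignment_set_row _ _ y Hu (num_Codes 0))
    (small_num _ _ H) (small_cut _ _ HS H) E) as L.
  rewrite !row_set_row_ne in L by auto. now apply L.
Qed.

(** The scratch register can hold the singleton of a value on the left. *)
Lemma good_bound t u del k : assignment t -> assignment u -> good t u del -> k <> 0 ->
  row u (num k) ∈ V del.
Proof.
  intros Ht Hu G Hk. destruct (good_agree _ _ _ G) as (xi & xi' & H & H' & F & K).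
  destruct (K (sing (row t (num k)))) as (y & Hy & E).
  pose proof (agree_mem xi xi' (small_numerals _ H) F (proj2 H') _ _ (num k) (num 0)
    (assignment_set_row _ _ _ Ht (num_Codes 0)) (assignment_set_row _ _ y Hu (num_Codes 0))
    (small_num _ _ H) (small_num _ _ H) E) as L.
  rewrite !row_set_row_eq, !row_set_row_ne in L by auto.
  apply (V_trans del y Hy). apply L. now apply in_sing.
Qed.

(** ** Moving an element of prescribed rank *)

Lemma cantor X (F : M -> M) : Dfun (fun e => F (e 0)) ->
  (forall y, y ∈ pow X -> F y ∈ X) ->
  exists y1 y2, y1 ∈ pow X /\ y2 ∈ pow X /\ y1 <> y2 /\ F y1 = F y2.
Proof.
  intros HF HX.
  destruct (separation_Sigma1 (fun w => exists y, y ∈ pow X /\ (w = F y /\ ~ w ∈ y)) X)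
    as [R HR].
  { apply Sigma1_exb; [definable|]. apply Delta1_Sigma1, Delta1_and; [|definable].
    apply Delta1_eq; [definable|]. apply Dfun_app1; [exact HF | definable]. }
  assert (RX : R ∈ pow X) by (apply in_pow; intros z Hz; now apply HR in Hz).
  destruct (classic (F R ∈ R)) as [H|H].
  - pose proof H as H'. apply HR in H'. destruct H' as (_ & y & Hy & E & N).
    exists R, y. repeat split; auto. intros <-. auto.
  - exfalso. apply H. apply HR. split; auto. exists R. auto.
Qed.

(** These elements of rank [al] encode all subsets of [X]: the second part does not
    meet [X] and is cofinal in [al]. *)
Lemma rk_cup_ord al X y : is_ord M al -> y ⊑ X ->
  trans X -> (forall z, z ∈ X -> rk z ∈ al) -> (exists b, b ∈ al /\ ~ b ∈ X) ->
  rk (cup y (sepf al (fun b => ~ b ∈ X))) = al.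
Proof.
  intros Ha Hy TX HX (b & Hb & Nb). destruct (Ha) as [Ta La].
  apply set_ext. intros z. rewrite in_rk. split.
  - intros (w & Hw & Hz). assert (Hr : rk w ∈ al).
    { apply in_cup in Hw. destruct Hw as [Hw|Hw]; [auto|].
      apply in_sepf in Hw; [|definable]. destruct Hw as [Hw _].
      rewrite rk_of_ord; auto. now apply (ord_mem al). }
    destruct Hz as [Hz| ->]; eauto.
  - intros Hz.
    assert (K : exists w, w ∈ al /\ ~ w ∈ X /\ (z ∈ w \/ z = w)).
    { destruct (classic (z ∈ X)) as [HzX|N]; [|exists z; auto].
      exists b. repeat split; auto. left.
      destruct (La z b Hz Hb) as [L|[L|L]]; auto; exfalso; apply Nb.
      - now subst b.
      - exact (TX z HzX b L). }
    destruct K as (w & Hw & Nw & Hzw). exists w. split.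
    + apply in_cup. right. apply in_sepf; [definable|]. auto.
    + rewrite rk_of_ord; auto. now apply (ord_mem al).
Qed.

(** There are more elements of rank [al] than there are types below a level
    below [al], so two of them share their type. *)
Lemma good_moved t u del k j al : assignment t -> assignment u -> good t u del -> k <> 0 ->
    j <> 0 ->
  is_ord M al -> ~ Cut al -> al ∈ V (row t (num j)) ->
  exists x b, rk x = al /\ b <> x /\ good (set_row t (num k) x) (set_row u (num k) b) del.
Proof.
  intros Ht Hu G Hk Hj Ha Na Hal.
  destruct (outside_ord al Ha Na) as (be & Hbe & Nbe & Hba).
  destruct (small_min xi0 be small_xi0 Nbe) as (xi & Hxi & _ & Hxb).
  destruct (small_far xi Hxi) as (xi1 & H1 & F1).
  destruct (small_far xi1 H1) as (xi2 & H2 & F2).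
  destruct (complete_ex (repl (V (row t (num j))) (fun a => set_row t (num k) a)) (num 0) xi2)
    as [gam C].
  pose (X := pow (V xi1)).
  assert (HXb : X ⊑ V be).
  { intros z Hz. apply Hxb, F1. apply (V_sings_mono 1 12); [lia|].
    apply in_V_sing. unfold X in Hz. now rewrite in_pow in Hz. }
  assert (TX : trans X).
  { intros z Hz w Hw. apply in_pow. unfold X in Hz. rewrite in_pow in Hz.
    intros v. exact (V_trans xi1 w (Hz w Hw) v). }
  pose (m := fun y => cup y (sepf al (fun b => ~ b ∈ X))).
  assert (Rm : forall y, y ∈ pow X -> rk (m y) = al).
  { intros y Hy. rewrite in_pow in Hy. apply rk_cup_ord; auto.
    - intros z Hz. apply HXb, V_to_rk in Hz. rewrite (rk_of_ord be) in Hz; auto.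
      destruct Ha as [T _]. exact (T be _ Hba Hz).
    - exists be. split; auto. intros K. apply HXb in K. now apply V_irrefl in K. }
  assert (Im : forall y, y ∈ pow X -> forall z, z ∈ y <-> z ∈ X /\ z ∈ m y).
  { intros y Hy z. rewrite in_pow in Hy. unfold m. rewrite in_cup, in_sepf by definable.
    split; [auto|]. intros [H [K|[_ K]]]; tauto. }
  destruct (cantor X (fun y => type_upto xi1 (set_row (set_row t (num k) (m y)) (num 0) gam)))
    as (y1 & y2 & Hy1 & Hy2 & Ny & E).
  { unfold m. definable. }
  { intros y _. apply in_pow. intros z Hz. now apply in_type_upto in Hz. }
  assert (Nm : m y1 <> m y2).
  { intros Em. apply Ny, set_ext. intros z. now rewrite (Im y1), (Im y2), Em by auto. }
  apply type_upto_agree in E.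
  assert (Vm : forall y, y ∈ pow X -> m y ∈ V (row t (num j))).
  { intros y Hy. apply rk_to_V. rewrite Rm by auto. apply V_to_rk in Hal.
    now rewrite rk_of_ord in Hal. }
  assert (G21 : good (set_row t (num k) (m y2)) (set_row t (num k) (m y1)) gam).
  { apply (good_of_agree xi2 xi1 _ _ gam); auto using agree_sym.
    intros x. apply C. apply in_repl; [definable|]. eauto. }
  destruct (proj1 (good_both t u del k j Ht Hu G Hk Hj) (m y1) (Vm y1 Hy1))
    as (b & _ & Gb).
  destruct (classic (b = m y1)) as [->|Nb].
  - exists (m y2), (m y1). repeat split; auto.
      now apply (good_trans _ (set_row t (num k) (m y1)) _ gam).
  - exists (m y1), b. auto.
Qed.

(** * The construction *)

(** ** Conditions *)

Hypothesis hcount : countable M.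

Record state := State { lft : M; rgt : M; bnd : M; next : nat }.

(** Registers from [next s] on are empty, hence free to be used by [good_raise]. *)
Definition valid s := assignment (lft s) /\ assignment (rgt s) /\ next s <> 0 /\
  (forall k, next s <= k -> row (lft s) (num k) = emp /\ row (rgt s) (num k) = emp) /\
  good (lft s) (rgt s) (bnd s).

Definition ext s s' := next s <= next s' /\ V (bnd s') ⊑ V (bnd s) /\
  forall k, k <> 0 -> k < next s ->
    row (lft s') (num k) = row (lft s) (num k) /\ row (rgt s') (num k) = row (rgt s) (num k).

Definition named s a b := exists k, k <> 0 /\ k < next s /\
  row (lft s) (num k) = a /\ row (rgt s) (num k) = b.

Lemma ext_refl s : ext s s.
Proof. repeat split; auto. Qed.

Lemma ext_trans s1 s2 s3 : ext s1 s2 -> ext s2 s3 -> ext s1 s3.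
Proof.
  intros (A & B & C) (D & E & F). split; [lia|]. split; [auto|].
  intros k Hk Hl. destruct (C k Hk Hl) as [C1 C2].
  destruct (F k Hk) as [F1 F2]; [lia|]. split; congruence.
Qed.

Lemma named_ext s s' a b : ext s s' -> named s a b -> named s' a b.
Proof.
  intros (A & _ & C) (k & Hk & Hl & E1 & E2). exists k.
  destruct (C k Hk Hl) as [C1 C2]. repeat split; auto; [lia|congruence|congruence].
Qed.

Lemma named_mem s a b a' b' : valid s -> named s a b -> named s a' b' ->
  (a ∈ a' <-> b ∈ b').
Proof.
  intros (Ht & Hu & _ & _ & G) (k & Hk & _ & <- & <-) (l & Hl & _ & <- & <-).
  now apply (good_mem _ _ (bnd s)).
Qed.

Lemma named_fix s a b : valid s -> named s a b -> Cut a -> b = a.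
Proof.
  intros (Ht & Hu & _ & _ & G) (k & Hk & _ & <- & <-) H.
  now apply (good_fix _ _ (bnd s)).
Qed.

Lemma named_bound s a b : valid s -> named s a b -> b ∈ V (bnd s).
Proof.
  intros (Ht & Hu & _ & _ & G) (k & Hk & _ & _ & <-). now apply (good_bound (lft s)).
Qed.

Definition add s a b :=
    State (set_row (lft s) (num (next s)) a) (set_row (rgt s) (num (next s)) b)
  (bnd s) (S (next s)).

Lemma add_valid s a b : valid s ->
  good (set_row (lft s) (num (next s)) a) (set_row (rgt s) (num (next s)) b) (bnd s) ->
  valid (add s a b) /\ ext s (add s a b) /\ named (add s a b) a b.
Proof.
  intros (Ht & Hu & N & E & _) G. unfold valid, ext, named, add; cbn. repeat split; auto.
  - rewrite row_set_row_ne; [apply E; lia | apply num_ne; lia].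
  - rewrite row_set_row_ne; [apply E; lia | apply num_ne; lia].
  - rewrite row_set_row_ne; [auto | apply num_ne; lia].
  - rewrite row_set_row_ne; [auto | apply num_ne; lia].
  - exists (next s). rewrite !row_set_row_eq. auto.
Qed.

Lemma set_bound s del : valid s -> good (lft s) (rgt s) del -> V del ⊑ V (bnd s) ->
  let s' := State (lft s) (rgt s) del (next s) in valid s' /\ ext s s'.
Proof.
  intros (Ht & Hu & N & E & _) G H. unfold valid, ext; cbn. repeat split; auto; now apply E.
Qed.

Lemma add_raise s c : valid s -> exists s' rho pi, valid s' /\ ext s s' /\
  named s' rho pi /\ c ∈ V rho /\ good (lft s) (rgt s) pi.
Proof.
  intros Hs. pose proof Hs as (Ht & Hu & N & E & G).
  destruct (E (next s) (le_n _)) as [E1 E2].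
  destruct (good_raise _ _ _ (next s) c Ht Hu G N E1 E2) as (rho & pi & Hc & G1 & G2).
  destruct (add_valid s rho pi Hs G1) as (A & B & C).
  exists (add s rho pi), rho, pi. auto.
Qed.

Lemma add_left s rho pi a : valid s -> named s rho pi -> a ∈ V rho ->
  exists s' b, valid s' /\ ext s s' /\ named s' a b /\ b ∈ V pi.
Proof.
  intros Hs (j & Hj & _ & <- & <-) Ha. pose proof Hs as (Ht & Hu & N & E & G).
  destruct (proj1 (good_both _ _ _ (next s) j Ht Hu G N Hj) a Ha) as (b & Hb & G').
  destruct (add_valid s a b Hs G') as (A & B & C). exists (add s a b), b. auto.
Qed.

Lemma add_right s rho pi b : valid s -> named s rho pi -> b ∈ V pi ->
  exists s' a, valid s' /\ ext s s' /\ named s' a b.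
Proof.
  intros Hs (j & Hj & _ & <- & <-) Hb. pose proof Hs as (Ht & Hu & N & E & G).
  destruct (proj2 (good_both _ _ _ (next s) j Ht Hu G N Hj) b Hb) as (a & Ha & G').
  destruct (add_valid s a b Hs G') as (A & B & C). exists (add s a b), a. auto.
Qed.

(** ** Requirements, met densely *)

Definition total_at m s := exists rho pi b,
  named s rho pi /\ m ∈ V rho /\ named s m b /\ b ∈ V pi.
(** An element that never falls below a recorded level on the right need not be
    in the image; stated for all extensions, this persists. *)
Definition onto_at m s := (exists a, named s a m) \/
  forall s', valid s' -> ext s s' -> forall rho pi, named s' rho pi -> ~ m ∈ V pi.
Definition topless_at m s := (exists rho pi, named s rho pi /\ m ∈ V pi) \/ bnd s ∈ V m.
Definition moved_at m s := is_ord M m -> ~ Cut m ->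
  exists x b, named s x b /\ rk x = m /\ b <> x.

Lemma total_dense m s : valid s -> exists s', valid s' /\ ext s s' /\ total_at m s'.
Proof.
  intros Hs. destruct (add_raise s m Hs) as (s1 & rho & pi & H1 & E1 & N1 & Hm & _).
  destruct (add_left s1 rho pi m H1 N1 Hm) as (s2 & b & H2 & E2 & N2 & Hb).
  exists s2. split; [|split]; auto.
  - now apply (ext_trans s s1).
  - exists rho, pi, b. repeat split; auto. now apply (named_ext s1).
Qed.

Lemma onto_dense m s : valid s -> exists s', valid s' /\ ext s s' /\ onto_at m s'.
Proof.
  intros Hs.
  destruct (classic (exists s', valid s' /\ ext s s' /\
    exists rho pi, named s' rho pi /\ m ∈ V pi)) as [(s1 & H1 & E1 & rho & pi & N & Hm)|N].
  - destruct (add_right s1 rho pi m H1 N Hm) as (s2 & a & H2 & E2 & N2).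
    exists s2. split; [|split]; auto.
    + now apply (ext_trans s s1).
    + left. eauto.
  - exists s. split; [|split]; auto using ext_refl. right.
    intros s' H' E' rho pi Hn Hm. apply N. exists s'. eauto 6.
Qed.

Lemma V_in_sub x y z : x ⊑ V y -> y ∈ V z -> x ∈ V z.
Proof. intros H K. apply (V_sub_closed z (V y)); auto. now apply V_in. Qed.

(** Either the bound can be lowered below [m], or the next recorded level,
    which is itself an admissible bound, lies above [m]. *)
Lemma topless_dense m s : valid s -> exists s', valid s' /\ ext s s' /\ topless_at m s'.
Proof.
  intros Hs.
  destruct (classic (exists del, good (lft s) (rgt s) del /\ del ∈ V m))
    as [(del & G & Hd)|N].
  - destruct (V_linear del (bnd s)) as [L|L].
    + destruct (set_bound s del Hs G (V_mono_in _ _ L)) as [A B].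
      eexists. split; [exact A|]. split; [exact B|]. right. exact Hd.
    + exists s. split; [|split]; auto using ext_refl. right.
      now apply (V_in_sub _ del).
  - destruct (add_raise s m Hs) as (s1 & rho & pi & H1 & E1 & N1 & _ & G).
    exists s1. split; [|split]; auto. left. exists rho, pi. split; auto.
    destruct (good_lower (lft s) (rgt s) pi) as (del & Hd & G'); try apply Hs; auto.
    destruct (V_linear del m) as [L|L]; [exfalso; eauto|].
    now apply (V_in_sub _ del).
Qed.

Lemma moved_dense m s : valid s -> exists s', valid s' /\ ext s s' /\ moved_at m s'.
Proof.
  intros Hs. destruct (classic (is_ord M m /\ ~ Cut m)) as [[Ho Hn]|N].
  - destruct (add_raise s m Hs) as (s1 & rho & pi & H1 & E1 & N1 & Hm & _).
    destruct N1 as (j & Hj & _ & <- & _).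
    pose proof H1 as (Ht & Hu & N & _ & G).
    destruct (good_moved _ _ _ (next s1) j m Ht Hu G N Hj Ho Hn Hm) as (x & b & Hx & Hb & G').
    destruct (add_valid s1 x b H1 G') as (A & B & C). exists (add s1 x b).
    split; [|split]; auto.
    + now apply (ext_trans s s1).
    + intros _ _. eauto.
  - exists s. split; [|split]; auto using ext_refl. intros H1 H2. tauto.
Qed.

Lemma total_ext m s s' : ext s s' -> total_at m s -> total_at m s'.
Proof.
  intros E (rho & pi & b & H1 & H2 & H3 & H4). exists rho, pi, b.
  repeat split; auto; now apply (named_ext s).
Qed.

Lemma onto_ext m s s' : ext s s' -> onto_at m s -> onto_at m s'.
Proof.
  intros E [[a H]|H].
  - left. exists a. now apply (named_ext s).
  - right. intros s2 V2 E2. apply H; auto. now apply (ext_trans s s').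
Qed.

Lemma topless_ext m s s' : ext s s' -> topless_at m s -> topless_at m s'.
Proof.
  intros E [(rho & pi & H & K)|H].
  - left. exists rho, pi. split; auto. now apply (named_ext s).
  - right. destruct E as (_ & E & _). apply (V_in_sub _ (bnd s)); auto.
    intros z Hz. apply E. now apply V_self.
Qed.

Definition meets n s := forall m,
    proj1_sig (constructive_indefinite_description _ hcount) m = n ->
  total_at m s /\ onto_at m s /\ topless_at m s /\ moved_at m s.

Lemma meets_dense n s : valid s -> exists s', valid s' /\ ext s s' /\ meets n s'.
Proof.
  unfold meets. destruct (constructive_indefinite_description _ hcount) as [f Hf]; cbn.
  intros Hs. destruct (classic (exists m, f m = n)) as [[m Hm]|N].
  - destruct (total_dense m s Hs) as (s1 & H1 & E1 & T).
    destruct (onto_dense m s1 H1) as (s2 & H2 & E2 & O).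
    destruct (topless_dense m s2 H2) as (s3 & H3 & E3 & P).
    destruct (moved_dense m s3 H3) as (s4 & H4 & E4 & Q).
    exists s4. split; [|split]; auto.
    + apply (ext_trans s s1); auto. apply (ext_trans s1 s2); auto. now apply (ext_trans s2 s3).
    + intros m' Hm'. assert (m' = m) as -> by (apply Hf; congruence).
      split; [|split; [|split]]; auto.
      * apply (total_ext m s1); auto. apply (ext_trans s1 s2); auto.
        now apply (ext_trans s2 s3).
      * apply (onto_ext m s2); auto. now apply (ext_trans s2 s3).
      * now apply (topless_ext m s3).
  - exists s. split; [|split]; auto using ext_refl. intros m Hm. exfalso. eauto.
Qed.

Lemma initial_state : exists s, valid s.
Proof.
  destruct (complete_single xi0 emp) as [gam C]. exists (State emp emp gam 1).
  unfold valid; cbn. repeat split; auto using assignment_emp, row_emp.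
  exists xi0. split; [apply small_xi0 | exact C].
Qed.

Lemma generic_sequence : exists s : nat -> state,
  (forall n, valid (s n)) /\ (forall n k, n <= k -> ext (s n) (s k)) /\
  forall n, meets n (s (S n)).
Proof.
  pose (T := {s | valid s}).
  assert (step : forall (n : nat) (s : T),
    {s' : T | ext (proj1_sig s) (proj1_sig s') /\ meets n (proj1_sig s')}).
  { intros n [s Hs]. apply constructive_indefinite_description.
    destruct (meets_dense n s Hs) as (s' & Hs' & E & K). exists (exist _ s' Hs'). auto. }
  destruct initial_state as [s0 H0].
  pose (q := fix q n := match n with
    | 0 => exist _ s0 H0 : T | S n => proj1_sig (step n (q n)) end).
  assert (Hq : forall n, ext (proj1_sig (q n)) (proj1_sig (q (S n))) /\
    meets n (proj1_sig (q (S n)))).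
  { intros n. exact (proj2_sig (step n (q n))). }
  exists (fun n => proj1_sig (q n)). split; [|split].
  - intros n. exact (proj2_sig (q n)).
  - intros n k L. induction L as [|k L IH]; [apply ext_refl|].
    apply (ext_trans _ _ _ IH). apply Hq.
  - intros n. apply Hq.
Qed.

(** ** The embedding *)

Theorem self_embedding : exists i : M -> M,
  rank_cut M M i /\ (forall s : M, Cut s -> i s = s) /\
  (forall alpha : M, is_ord M alpha -> ~ Cut alpha ->
     exists m : M, has_rank M m alpha /\ i m <> m).
Proof.
  destruct generic_sequence as (s & Hv & He & Hm).
  pose (R := fun a b => exists n, named (s n) a b).
  assert (Met : forall m, exists n,
    total_at m (s n) /\ onto_at m (s n) /\ topless_at m (s n) /\ moved_at m (s n)).
  { intros m. eexists (S _). apply (Hm _ m). reflexivity. }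
  assert (Rmem : forall a b a' b', R a b -> R a' b' -> (a ∈ a' <-> b ∈ b')).
  { intros a b a' b' [n H] [k K]. apply (named_mem (s (n + k))); auto.
    - apply (named_ext (s n)); auto. apply He. lia.
    - apply (named_ext (s k)); auto. apply He. lia. }
  assert (Rtot : forall a, exists b, R a b).
  { intros a. destruct (Met a) as (n & (_ & _ & b & _ & _ & H & _) & _).
    exists b, n. exact H. }
  assert (Ronto : forall rho pi x, R rho pi -> x ∈ V pi -> exists c, R c x).
  { intros rho pi x [n H] Hx. destruct (Met x) as (k & _ & [[c K]|K] & _).
    - exists c, k. exact K.
    - exfalso. apply (K (s (n + k)) (Hv _)) with (rho := rho) (pi := pi); auto.
      + apply He. lia.
      + apply (named_ext (s n)); auto. apply He. lia. }
  assert (Rfun : forall a b b', R a b -> R a b' -> b = b').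
  { intros a b b' H H'. apply set_ext. intros x. split; intros Hx.
    - destruct (Ronto a b x H) as [c Hc]; [now apply V_self|].
      apply (Rmem c x a b' Hc H'). now apply (Rmem c x a b Hc H).
    - destruct (Ronto a b' x H') as [c Hc]; [now apply V_self|].
      apply (Rmem c x a b Hc H). now apply (Rmem c x a b' Hc H'). }
  assert (Rinj : forall a a' b, R a b -> R a' b -> a = a').
  { intros a a' b H H'. apply set_ext. intros x. destruct (Rtot x) as [y Hy].
    now rewrite (Rmem x y a b Hy H), (Rmem x y a' b Hy H'). }
  pose (i := fun a => proj1_sig (constructive_indefinite_description _ (Rtot a))).
  assert (Ri : forall a, R a (i a)).
  { intros a. exact (proj2_sig (constructive_indefinite_description _ (Rtot a))). }
  assert (Req : forall a b, R a b -> i a = b).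
  { intros a b H. exact (Rfun a _ _ (Ri a) H). }
  exists i. split; [split; [|split]|split].
  - split.
    + intros a a' E. apply (Rinj a a' (i a)); auto. rewrite E. auto.
    + intros x y. apply Rmem; auto.
  - intros m n H. rewrite rank_le_iff in H.
    destruct (Met m) as (k & (rho & pi & b & N1 & _ & N2 & Hb) & _).
    assert (i m = b) as E by (apply Req; exists k; exact N2). rewrite E in H.
    destruct (Ronto rho pi n) as [a Ha]; [exists k; exact N1 | |].
    + now apply (V_in_sub _ b).
    + exists a. now apply Req.
  - assert (Rb : forall m n, exists k, n <= k /\ i m ∈ V (bnd (s k))).
    { intros m n. destruct (Ri m) as [k K]. exists (n + k). split; [lia|].
      apply (named_bound _ m); auto. apply (named_ext (s k)); auto. apply He. lia. }
    assert (Rb' : forall m n, i m ∈ V (bnd (s n))).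
    { intros m n. destruct (Rb m n) as (k & L & K). destruct (He n k L) as (_ & Hb & _). auto. }
    split.
    + exists (rk (bnd (s 0))). split; [apply rk_ord|].
      intros m. apply below_rank_iff; [apply rk_ord|]. rewrite V_rk. apply Rb'.
    + intros b Hb Nb. destruct (Met b) as (n & _ & _ & [(rho & pi & K & L)|K] & _).
      * exfalso. apply Nb. destruct (Ronto rho pi b) as [a Ha]; auto; [exists n; auto|].
        exists a. now apply Req.
      * exists (rk (bnd (s n))). split; [apply rk_ord|]. split.
        -- intros [m E]. pose proof (Rb' m n) as L. rewrite E, <- V_rk in L.
           now apply V_irrefl in L.
        -- apply V_to_rk in K. now rewrite (rk_of_ord b) in K.
  - intros x Hx. destruct (Ri x) as [n H]. now apply (named_fix (s n)).
  - intros al Ha Na. destruct (Met al) as (n & _ & _ & _ & K).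
    destruct (K Ha Na) as (x & b & Hx & E & Nb). exists x. split.
    + apply has_rank_iff. auto.
    + rewrite (Req x b); auto. exists n. exact Hx.
Qed.

End Model.

Theorem theorem7p8 (M : structure)
    (hKPP : models M KPP)
    (hSep : models M (Separation (SigmaP 1)))
    (hcount : countable M)
    (hnonstd : nonstandard M)
    (S : M -> Prop)
    (hS : is_rank_cut_of M S) :
  exists i : M -> M,
    rank_cut M M i /\
    (forall s : M, S s -> i s = s) /\
    (forall alpha : M, is_ord M alpha -> ~ S alpha ->
       exists m : M, has_rank M m alpha /\ i m <> m).
Proof.
  pose proof hS as (_ & _ & (m0 & _) & _).
  destruct (cut_bounded M hKPP hSep m0 S hS) as [xi0 hxi0].
  exact (self_embedding M hKPP hSep m0 xi0 S hS hxi0 hcount).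
Qed.
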